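(* A strongly lim Cohen-Macaulay sequence of modules over a local ring is lim Cohen-Macaulay.
   Context: Let $(R,\mathfrak m,K)$ be a (Noetherian) local ring of Krull dimension $d$; $\ell$ is length, $\nu(M)=\dim_K(K\otimes_RM)$, $H_i(\underline x;M)$ is Koszul homology, $H^j_{\mathfrak m}$ is local cohomology. For a family $\mathcal V$ of $R$-modules and an $R$-module $H$, $\ell_{\mathcal V}(H)$ is $0$ if $H=0$, and otherwise the shortest length of a finite filtration of $H$ all of whose factors are isomorphic to modules in $\mathcal V$ ($+\infty$ if no such filtration exists). A sequence $\{M_n\}_n$ of finitely generated $R$-modules is strongly lim Cohen-Macaulay if every $M_n$ has Krull dimension $d$ and there is a finite set $\mathcal V=\{V_1,\dots,V_a\}$ of Artinian $R$-modules such that $\ell_{\mathcal V}(H^j_{\mathfrak m}(M_n))=\mathrm o(\nu(M_n))$ as $n\to\infty$ for every $j<d$. A sequence $\{M_n\}_n$ of nonzero finitely generated $R$-modules is lim Cohen-Macaulay if for some (equivalently, every) system of parameters $\underline x$ of $R$, $\ell(H_i(\underline x;M_n))=\mathrm o(\nu(M_n))$ for all $i\ge1$. *)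

(* Defs.v *)
From HB Require Import structures.
From mathcomp Require Import all_boot all_order all_algebra.
From mathcomp Require Import boolp.

Set Implicit Arguments.
Unset Strict Implicit.
Unset Printing Implicit Defensive.

Import Order.TTheory GRing.Theory Num.Theory.
Local Open Scope ring_scope.
Local Open Scope quotient_scope.

(* A submodule of M : lmodType R is an element of submodClosed M, and an      *)
(* ideal of the commutative ring R is a submodule of R^o.                     *)

Section Modules.
Variable R : comNzRingType.

Section Submodules.
Variable M : lmodType R.

Definition submod_pred (P : M -> Prop) : M -> bool := fun x => `[< P x >].

Section MkSubmod.
Variables (P : M -> Prop) (P0 : P 0)
  (PD : forall a x y, P x -> P y -> P (a *: x + y)).

Fact submod_pred_closed : subsemimod_closed (submod_pred P).
Proof.
apply: GRing.submod_closed_semi; split=> [|a x y /asboolP Px /asboolP Py].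
  exact/asboolP.
exact/asboolP/PD.
Qed.

Definition mk_submod : submodClosed M :=
  HB.pack (submod_pred P)
    (GRing.isSubmodClosed.Build R M (submod_pred P) submod_pred_closed).

Fact mk_submodP x : reflect (P x) (x \in mk_submod).
Proof. by rewrite -[x \in _]/`[< P x >]; exact: asboolP. Qed.
End MkSubmod.

Section Span.
Variable X : M -> Prop.

Let in_span (x : M) : Prop :=
  forall N : submodClosed M, (forall y, X y -> y \in N) -> x \in N.

Fact span_subproof0 : in_span 0.
Proof. by move=> N _; exact: rpred0. Qed.

Fact span_subproofD a x y : in_span x -> in_span y -> in_span (a *: x + y).
Proof.
by move=> Sx Sy N XN; apply: rpredD; [apply/rpredZ/Sx | apply: Sy].
Qed.

Definition span : submodClosed M := mk_submod span_subproof0 span_subproofD.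
End Span.

Definition zero_submod : submodClosed M := span (fun=> False).
Definition full_submod : submodClosed M := span (fun=> True).

Definition sub_le (N N' : submodClosed M) : Prop := {subset N <= N'}.
Definition sub_lt (N N' : submodClosed M) : Prop :=
  sub_le N N' /\ ~ sub_le N' N.

Definition fin_gen_submod (N : submodClosed M) : Prop :=
  exists s : seq M, span (fun x => x \in s) =i N.

Definition fin_gen : Prop := fin_gen_submod full_submod.

Definition artinian : Prop :=
  forall N : nat -> submodClosed M, (forall i, sub_le (N i.+1) (N i)) ->
  exists k, forall i, (k <= i)%N -> N i =i N k.

Definition sub_type (N : submodClosed M) : Type := {x : M | x \in N}.

Section SubType.
Variable N : submodClosed M.
HB.instance Definition _ := SubChoice.on (sub_type N).
HB.instance Definition _ := [SubChoice_isSubLmodule of sub_type N by <:].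
End SubType.

Definition submod_mem (N : submodClosed M) : M -> bool := fun x => x \in N.

Fact submod_mem_zmod_closed N : zmod_closed (submod_mem N).
Proof. exact: GRing.submod_closedB (submodClosedP N). Qed.

Definition submod_zmod (N : submodClosed M) : zmodClosed M :=
  HB.pack (submod_mem N)
    (GRing.isZmodClosed.Build M (submod_mem N) (@submod_mem_zmod_closed N)).

Definition quo_type (N : submodClosed M) : Type :=
  Quotient.quot (submod_zmod N).

Section QuotientModule.
Variable N : submodClosed M.
HB.instance Definition _ := GRing.Zmodule.on (quo_type N).

Definition quo_pi (x : M) : quo_type N := \pi_(Quotient.quot (submod_zmod N)) x.
Definition quo_repr (q : quo_type N) : M := repr (q : Quotient.quot (submod_zmod N)).

Fact quo_reprK : cancel quo_repr quo_pi. Proof. exact: reprK. Qed.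

Fact quo_piE x y : quo_pi x = quo_pi y <-> x - y \in N.
Proof. rewrite (_ : (_ \in _) = (x - y \in submod_zmod N)) // Quotient.idealrBE.
by split=> /eqP. Qed.

Fact quo_piD x y : quo_pi (x + y) = quo_pi x + quo_pi y.
Proof. exact: (raddfD (\pi_(Quotient.quot (submod_zmod N)) : {additive _ -> _})). Qed.

Definition quo_scale (a : R) (q : quo_type N) : quo_type N :=
  quo_pi (a *: quo_repr q).

Fact quo_scaleE a x : quo_scale a (quo_pi x) = quo_pi (a *: x).
Proof.
by apply/quo_piE; rewrite -scalerBr; apply/rpredZ/quo_piE; rewrite quo_reprK.
Qed.

Fact quo_scaleA a b q : quo_scale a (quo_scale b q) = quo_scale (a * b) q.
Proof. by rewrite -[q]quo_reprK !quo_scaleE scalerA. Qed.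

Fact quo_scale1 : left_id 1 quo_scale.
Proof. by move=> q; rewrite -[q]quo_reprK quo_scaleE scale1r. Qed.

Fact quo_scaleDr : right_distributive quo_scale +%R.
Proof.
move=> a p q; rewrite -[p]quo_reprK -[q]quo_reprK.
by rewrite -quo_piD !quo_scaleE -quo_piD scalerDr.
Qed.

Fact quo_scaleDl q : {morph quo_scale^~ q : a b / a + b}.
Proof.
by move=> a b /=; rewrite -[q]quo_reprK !quo_scaleE -quo_piD scalerDl.
Qed.

HB.instance Definition _ := GRing.Zmodule_isLmodule.Build R (quo_type N)
  quo_scaleA quo_scale1 quo_scaleDr quo_scaleDl.
End QuotientModule.

End Submodules.

Definition isomorphic (M N : lmodType R) : Prop :=
  exists f : {linear M -> N}, bijective f.

Section SubmodIn.
Variables (M : lmodType R) (A B : submodClosed M).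

Fact submod_in_subproof0 : val (0 : sub_type A) \in B.
Proof. by rewrite raddf0 rpred0. Qed.

Fact submod_in_subproofD a (x y : sub_type A) :
  val x \in B -> val y \in B -> val (a *: x + y) \in B.
Proof. by move=> Bx By; rewrite linearP rpredD ?rpredZ. Qed.

Definition submod_in : submodClosed (sub_type A) :=
  mk_submod submod_in_subproof0 submod_in_subproofD.

(* This is A / (A :&: B); it is only used when B is contained in A. *)
Definition subquotient : lmodType R := quo_type submod_in.
End SubmodIn.

Section KernelImage.
Variables (A B : lmodType R) (f : {linear A -> B}).

Fact kernel_subproofD a x y : f x = 0 -> f y = 0 -> f (a *: x + y) = 0.
Proof. by move=> fx fy; rewrite linearP fx fy scaler0 addr0. Qed.

Definition kernel : submodClosed A := mk_submod (linear0 f) kernel_subproofD.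

Fact image_subproof0 : exists x, f x = 0.
Proof. by exists 0; rewrite linear0. Qed.

Fact image_subproofD a y y' : (exists x, f x = y) -> (exists x, f x = y') ->
  exists x, f x = a *: y + y'.
Proof. by move=> [x <-] [x' <-]; exists (a *: x + x'); rewrite linearP. Qed.

Definition image : submodClosed B := mk_submod image_subproof0 image_subproofD.
End KernelImage.

(* Homology at B of a complex A --f--> B --g--> C. *)
Definition homology (A B C : lmodType R)
    (f : {linear A -> B}) (g : {linear B -> C}) : lmodType R :=
  subquotient (kernel g) (image f).

Definition smul (I : submodClosed R^o) {M : lmodType R} (N : submodClosed M) :
    submodClosed M :=
  span (fun x => exists2 a : R, a \in I & exists2 y, y \in N & x = a *: y).

Definition ideal_pow (I : submodClosed R^o) (k : nat) : submodClosed R^o :=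
  iter k (smul I) (full_submod R^o).

Definition noetherian : Prop := forall I : submodClosed R^o, fin_gen_submod I.

Definition maximal_ideal (I : submodClosed R^o) : Prop :=
  (1 : R) \notin I /\
  forall J : submodClosed R^o, sub_le I J -> (1 : R) \notin J -> J =i I.

Definition local_ring (m : submodClosed R^o) : Prop :=
  maximal_ideal m /\ forall I, maximal_ideal I -> I =i m.

Definition prime_ideal (P : submodClosed R^o) : Prop :=
  (1 : R) \notin P /\
  forall a b : R, a * b \in P -> (a \in P) || (b \in P).

(* Chains of n + 1 primes of R containing the annihilator of M. *)
Definition prime_chain (M : lmodType R) (n : nat) : Prop :=
  exists P : nat -> submodClosed R^o,
    [/\ forall i, (i <= n)%N -> prime_ideal (P i),
        forall i, (i <= n)%N ->
          forall a : R, (forall x : M, a *: x = 0) -> a \in P i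
      & forall i, (i < n)%N -> sub_lt (P i) (P i.+1)].

(* The Krull dimension of M is the natural number n (so M is nonzero); the    *)
(* Krull dimension of R is that of R^o.                                       *)
Definition has_krull_dim (M : lmodType R) (n : nat) : Prop :=
  prime_chain M n /\ forall k, prime_chain M k -> (k <= n)%N.

(* The value Some n, for an n such that P n, or None (standing for +oo) if    *)
(* there is none. It is applied to properties with at most one solution.      *)
Definition the_nat (P : nat -> Prop) : option nat :=
  match pselect (exists n, P n) with
  | left exP => Some (projT1 (cid exP))
  | right _ => None
  end.

Definition submod_chain (H : lmodType R) (n : nat) : Prop :=
  exists F : nat -> submodClosed H,
    forall i, (i < n)%N -> sub_lt (F i) (F i.+1).

Definition module_length (H : lmodType R) : option nat :=
  the_nat (fun n => submod_chain H n /\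
                    forall k, submod_chain H k -> (k <= n)%N).

Definition has_filtration (I : Type) (V : I -> lmodType R) (H : lmodType R)
    (n : nat) : Prop :=
  exists F : nat -> submodClosed H,
    [/\ F 0%N =i zero_submod H, F n =i full_submod H
      & forall i, (i < n)%N -> sub_le (F i) (F i.+1) /\
          exists v, isomorphic (subquotient (F i.+1) (F i)) (V v)].

(* The zero module has a filtration with no factor. *)
Definition family_length (I : Type) (V : I -> lmodType R) (H : lmodType R) :
    option nat :=
  the_nat (fun n => has_filtration V H n /\
                    forall k, has_filtration V H k -> (n <= k)%N).

(* K (x)_R M = M / mM, and r : R acts on it as its class in K = R / m.        *)
Definition is_basis_mod (m : submodClosed R^o) (M : lmodType R) (n : nat)
    (b : 'I_n -> quo_type (smul m (full_submod M))) : Prop :=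
  (forall q, exists r : 'I_n -> R, q = \sum_i r i *: b i) /\
  (forall r : 'I_n -> R, \sum_i r i *: b i = 0 -> forall i, r i \in m).

(* The junk value 0 is not reached when M is finitely generated. *)
Definition nu (m : submodClosed R^o) (M : lmodType R) : nat :=
  odflt 0%N (the_nat (fun n => exists b, @is_basis_mod m M n b)).

Section Koszul.
Variables (n : nat) (x : 'I_n -> R) (M : lmodType R).

Definition subsets (i : nat) : Type := {S : {set 'I_n} | #|S| == i}.
HB.instance Definition _ i := Finite.on (subsets i).

(* The component of degree i: f stands for the sum of the e_S (x) f S, where  *)
(* e_S is the exterior product of the basis vectors indexed by S.             *)
Definition koszul (i : nat) : lmodType R :=
  {ffun subsets i -> M}.

(* e_S |-> \sum_(s in S) (-1) ^ #{t in S | t < s} x_s e_(S \ s) *)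
Definition koszul_diff_fun (i : nat) (f : koszul i.+1) : koszul i :=
  [ffun T : subsets i =>
     \sum_(S : subsets i.+1) \sum_(s in sval S | sval S :\ s == sval T)
       ((-1) ^+ #|[set t in sval S | (t < s)%N]| * x s) *: f S].

Fact koszul_diff_linear i : linear (@koszul_diff_fun i).
Proof.
move=> a f g; apply/ffunP=> T; rewrite !ffunE scaler_sumr -big_split /=.
apply: eq_bigr => S _; rewrite scaler_sumr -big_split /=.
apply: eq_bigr => s _; rewrite !ffunE scalerDr !scalerA.
by congr (_ *: _ + _); rewrite mulrC.
Qed.

HB.instance Definition _ i :=
  GRing.isLinear.Build R (koszul i.+1) (koszul i) _ (@koszul_diff_fun i)
    (@koszul_diff_linear i).

Definition koszul_diff (i : nat) : {linear koszul i.+1 -> koszul i} :=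
  @koszul_diff_fun i.

Definition koszul_homology (i : nat) : lmodType R :=
  match i with
  | 0 => homology (koszul_diff 0) (\0 : {linear koszul 0 -> koszul 0})
  | j.+1 => homology (koszul_diff j.+1) (koszul_diff j)
  end.
End Koszul.

(* Injectivity is tested on the modules of the universe of lmodType. *)
Definition injective_module (E : lmodType R) : Prop :=
  forall (A B : lmodType R) (i : {linear A -> B}) (f : {linear A -> E}),
    injective i -> exists g : {linear B -> E}, forall a, g (i a) = f a.

Record injective_resolution (M : lmodType R) := InjectiveResolution {
  res_obj : nat -> lmodType R;
  res_diff : forall j, {linear res_obj j -> res_obj j.+1};
  res_aug : {linear M -> res_obj 0%N};
  _ : forall j, injective_module (res_obj j);
  _ : injective res_aug;
  _ : image res_aug =i kernel (res_diff 0%N);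
  _ : forall j, image (res_diff j) =i kernel (res_diff j.+1)
}.

Section LocalCohomology.
Variable m : submodClosed R^o.

Section Torsion.
Variable M : lmodType R.

Let in_torsion (x : M) : Prop :=
  exists k, forall a : R, a \in ideal_pow m k -> a *: x = 0.

Fact torsion_subproof0 : in_torsion 0.
Proof. by exists 0%N => a _; rewrite scaler0. Qed.

Fact ideal_powS_le k l :
  (k <= l)%N -> sub_le (ideal_pow m l) (ideal_pow m k).
Proof.
have step j : sub_le (ideal_pow m j.+1) (ideal_pow m j).
  by move=> a /mk_submodP; apply=> _ [b _ [c jc ->]]; exact: rpredZ.
elim: l => [|l IHl]; first by rewrite leqn0 => /eqP-> a.
rewrite leq_eqVlt => /predU1P[-> a //|].
by rewrite ltnS => /IHl IH a /step/IH.
Qed.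

Fact torsion_subproofD a x y :
  in_torsion x -> in_torsion y -> in_torsion (a *: x + y).
Proof.
move=> [k xk] [l yl]; exists (maxn k l) => b bkl.
rewrite scalerDr scalerA mulrC -scalerA xk ?yl ?scaler0 ?addr0 //.
  exact: (ideal_powS_le (leq_maxr k l)) bkl.
exact: (ideal_powS_le (leq_maxl k l)) bkl.
Qed.

Definition torsion : submodClosed M :=
  mk_submod torsion_subproof0 torsion_subproofD.

Fact torsionP x : reflect
  (exists k, forall a : R, a \in ideal_pow m k -> a *: x = 0) (x \in torsion).
Proof. exact: mk_submodP. Qed.
End Torsion.

Section TorsionMap.
Variables (A B : lmodType R) (f : {linear A -> B}).

Fact torsion_map_subproof (x : sub_type (torsion A)) : f (val x) \in torsion B.
Proof.
have /torsionP[k xk] := valP x; apply/torsionP; exists k => a /xk ax0.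
by rewrite -linearZ ax0 linear0.
Qed.

Definition torsion_map_fun (x : sub_type (torsion A)) : sub_type (torsion B) :=
  Sub (f (val x)) (torsion_map_subproof x).

Fact torsion_map_linear : linear torsion_map_fun.
Proof. by move=> a x y; apply: val_inj; rewrite /= linearP. Qed.

HB.instance Definition _ := GRing.isLinear.Build R (sub_type (torsion A))
  (sub_type (torsion B)) _ torsion_map_fun torsion_map_linear.

Definition torsion_map :
    {linear sub_type (torsion A) -> sub_type (torsion B)} :=
  torsion_map_fun.
End TorsionMap.

(* Local cohomology is the right derived functor of the m-torsion functor. *)
Definition local_cohomology (M : lmodType R) (E : injective_resolution M)
    (j : nat) : lmodType R :=
  match j with
  | 0 => homology
      (\0 : {linear sub_type (torsion (res_obj E 0)) ->
                    sub_type (torsion (res_obj E 0))})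
      (torsion_map (res_diff E 0))
  | k.+1 => homology (torsion_map (res_diff E k))
                     (torsion_map (res_diff E k.+1))
  end.
End LocalCohomology.

Definition system_of_parameters (m : submodClosed R^o) (d : nat)
    (x : 'I_d -> R) : Prop :=
  [/\ has_krull_dim R^o d, forall i, x i \in m
    & forall a : R, a \in m ->
        exists k, (a ^+ k : R^o) \in span (fun y : R^o => exists i, y = x i)].

(* u n = o(v n), where None stands for +oo. *)
Definition is_littleo (u : nat -> option nat) (v : nat -> nat) : Prop :=
  forall e : rat, 0 < e -> exists N, forall n, (N <= n)%N ->
    exists2 k, u n = Some k & k%:R <= e * (v n)%:R.

(* H^j_m(M n) is computed from some injective resolution of M n: it does not  *)
(* depend on this choice up to isomorphism.                                   *)
Definition strongly_lim_cohen_macaulay (m : submodClosed R^o) (d : nat)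
    (M : nat -> lmodType R) : Prop :=
  [/\ forall n, fin_gen (M n),
      forall n, has_krull_dim (M n) d
    & exists (E : forall n, injective_resolution (M n))
             (a : nat) (V : 'I_a -> lmodType R),
        (forall v, artinian (V v)) /\
        forall j, (j < d)%N ->
          is_littleo (fun n => family_length V (local_cohomology m (E n) j))
                     (fun n => nu m (M n))].

Definition lim_cohen_macaulay (m : submodClosed R^o) (d : nat)
    (M : nat -> lmodType R) : Prop :=
  [/\ forall n, fin_gen (M n),
      forall n, exists x : M n, x <> 0
    & exists2 x : 'I_d -> R, system_of_parameters m x &
        forall i, (1 <= i)%N ->
          is_littleo (fun n => module_length (koszul_homology x (M n) i))
                     (fun n => nu m (M n))].

End Modules.

(* Main.v *)
Require Import Defs.
From mathcomp Require Import all_boot all_order all_algebra.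
From mathcomp Require Import boolp ring.
From mathcomp Require classical_sets.
Import Defs Order.TTheory GRing.Theory Num.Theory.
Local Open Scope ring_scope.

(* Choose a system of parameters x of R by prime avoidance, and an injective
   resolution E of M. If I is injective, then multiplication by x_i is bijective
   on the i-th quotient of the filtration of I by the elements that are torsion
   with respect to x_1, ..., x_i; as x_i is null-homotopic on the Koszul complex,
   I / Gamma_m(I) is Koszul acyclic.

   Let C^j be the cocycles of E, Z^j and B^j those cocycles and coboundaries of
   Gamma_m(E), so that M = C^0 and H^j_m(M) = Z^j / B^j. The exact sequences
     0 -> C^j / Z^j -> E^j / Gamma_m(E^j) -> C^(j+1) / B^(j+1) -> 0
   have an acyclic middle term, hence
     H_i(C^j / Z^j) = H_(i+1)(C^(j+1) / B^(j+1)),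
   and the length of the latter is at most the sum of those of
   H_(i+1)(H^(j+1)_m(M)) and H_(i+1)(C^(j+1) / Z^(j+1)). Iterating, H_i(x; M) has
   length at most the sum over j of the lengths of H_(i+j)(x; H^j_m(M)). For
   i >= 1 only j < d contributes, because Koszul homology vanishes in degrees
   above d. Each term is at most c times the V-length of H^j_m(M), where c bounds
   the lengths of the Koszul homology of the finitely many V_v; these are finite
   because the homology is Artinian and killed by x. *)

Set Implicit Arguments.
Unset Strict Implicit.
Unset Printing Implicit Defensive.

(** * Submodules, chains and lengths *)

Section Submodules.
Variables (R : comNzRingType) (M : lmodType R).
Implicit Types (N P Q : submodClosed M) (x y : M).


Lemma mem_full_submod x : x \in full_submod M.
Proof. by apply/mk_submodP => N; apply. Qed.

Lemma submodB N x y : x \in N -> y \in N -> x - y \in N.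
Proof. by move=> Nx Ny; rewrite -scaleN1r rpredD ?rpredZ. Qed.

Fact add_submod_closed0 P Q :
  exists2 y, y \in P & exists2 z, z \in Q & 0 = y + z.
Proof. by exists 0; rewrite ?rpred0//; exists 0; rewrite ?rpred0 ?addr0. Qed.

Fact add_submod_closedD P Q a x x' :
  (exists2 y, y \in P & exists2 z, z \in Q & x = y + z) ->
  (exists2 y, y \in P & exists2 z, z \in Q & x' = y + z) ->
  exists2 y, y \in P & exists2 z, z \in Q & a *: x + x' = y + z.
Proof.
move=> [y Py [z Qz ->]] [y' Py' [z' Qz' ->]].
exists (a *: y + y'); first by rewrite rpredD ?rpredZ.
exists (a *: z + z'); first by rewrite rpredD ?rpredZ.
by rewrite scalerDr addrACA.
Qed.

Definition add_submod P Q : submodClosed M :=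
  mk_submod (add_submod_closed0 P Q) (@add_submod_closedD P Q).

Lemma sub_addl P Q : sub_le P (add_submod P Q).
Proof.
by move=> x Px; apply/mk_submodP; exists x => //; exists 0; rewrite ?rpred0 ?addr0.
Qed.

Lemma sub_addr P Q : sub_le Q (add_submod P Q).
Proof.
by move=> x Px; apply/mk_submodP; exists 0; rewrite ?rpred0//; exists x; rewrite ?add0r.
Qed.

Lemma add_submod_le P Q N :
  sub_le P N -> sub_le Q N -> sub_le (add_submod P Q) N.
Proof.
by move=> PN QN x /mk_submodP[y /PN Ny [z /QN Nz ->]]; rewrite rpredD.
Qed.

Fact cap_submod_closed0 P Q : (0 \in P) /\ (0 \in Q).
Proof. by rewrite !rpred0. Qed.

Fact cap_submod_closedD P Q a x x' :
  (x \in P) /\ (x \in Q) -> (x' \in P) /\ (x' \in Q) ->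
  (a *: x + x' \in P) /\ (a *: x + x' \in Q).
Proof. by move=> [? ?] [? ?]; rewrite !rpredD ?rpredZ. Qed.

Definition cap_submod P Q : submodClosed M :=
  mk_submod (cap_submod_closed0 P Q) (@cap_submod_closedD P Q).

Lemma sub_capl P Q : sub_le (cap_submod P Q) P.
Proof. by move=> x /mk_submodP[]. Qed.

Lemma sub_capr P Q : sub_le (cap_submod P Q) Q.
Proof. by move=> x /mk_submodP[]. Qed.

Lemma cyclic_subproof0 x : exists r : R, 0 = r *: x.
Proof. by exists 0; rewrite scale0r. Qed.

Lemma cyclic_subproofD x a y y' : (exists r : R, y = r *: x) ->
  (exists r : R, y' = r *: x) -> exists r : R, a *: y + y' = r *: x.
Proof. by move=> [r ->] [s ->]; exists (a * r + s); rewrite scalerDl scalerA. Qed.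

Definition cyclic x : submodClosed M :=
  mk_submod (cyclic_subproof0 x) (@cyclic_subproofD x).

Lemma mem_cyclic x : x \in cyclic x.
Proof. by apply/mk_submodP; exists 1; rewrite scale1r. Qed.

Fact is_zero_closedD (a : R) x y : x = 0 -> y = 0 -> a *: x + y = 0.
Proof. by move=> -> ->; rewrite scaler0 addr0. Qed.

Lemma mem_zero_submod x : (x \in zero_submod M) = (x == 0).
Proof.
apply/idP/eqP => [|->]; last exact: rpred0.
pose Z : submodClosed M := mk_submod (P := fun y => y = 0) erefl is_zero_closedD.
by move=> /mk_submodP/(_ Z) Zx; have /mk_submodP : x \in Z by apply: Zx.
Qed.

Lemma zero_submod_le P : sub_le (zero_submod M) P.
Proof. by move=> x; rewrite mem_zero_submod => /eqP->; apply: rpred0. Qed.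

End Submodules.

Section Chains.
Variables (R : comNzRingType).

Section Length.
Variable M : lmodType R.
Implicit Types (N A B P Q : submodClosed M).

(** Anchoring chains between two submodules of the ambient module bounds the length of a subquotient
    without forming it. The lowest term only has to contain [B], while the top term is [P]
    itself. *)
Fixpoint chain B k P : Prop :=
  if k is j.+1 then exists2 Q, chain B j Q & sub_lt Q P else sub_le B P.

Lemma chain_le B k P : chain B k P -> sub_le B P.
Proof.
elim: k P => [//|k IHk] P /= [Q /IHk BQ [QP _]] x /BQ; exact: QP.
Qed.

Lemma chain_weaken B k P P' : sub_le P P' -> chain B k P -> chain B k P'.
Proof.
case: k => [|k] /= PP'; first by move=> BP x /BP/PP'.
move=> [Q BQ [QP nPQ]]; exists Q => //; split; first by move=> x /QP/PP'.
by move=> P'Q; apply: nPQ => x /PP'/P'Q.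
Qed.

Definition len_le B A (L : nat) : Prop := forall k, chain B k A -> (k <= L)%N.

Lemma len_le0 B A : sub_le A B -> len_le B A 0.
Proof.
move=> AB [//|k] /= [Q /chain_le BQ [_ nAQ]]; case: nAQ => x /AB; exact: BQ.
Qed.

Lemma len_le_leq B A L L' : (L <= L')%N -> len_le B A L -> len_le B A L'.
Proof. by move=> LL' lL k /lL /leq_trans; apply. Qed.

Lemma len_le_mono B A A' L : sub_le A' A -> len_le B A L -> len_le B A' L.
Proof. by move=> A'A lL k /(chain_weaken A'A)/lL. Qed.

(** Modular law: if [Q < P] have the same intersection with [Y], their sums with [Y] differ. Each
    step of the chain is charged to the intersections or else to the sums. *)
Lemma chain_split B Y k P : sub_le B Y -> chain B k P ->
  exists a b, [/\ (a + b = k)%N, chain B a (cap_submod P Y) &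
                  chain Y b (add_submod P Y)].
Proof.
move=> BY; elim: k P => [|k IHk] P /= ch.
  exists 0%N, 0%N; split=> //=; last exact: sub_addr.
  by move=> x Bx; apply/mk_submodP; split; [apply: ch | apply: BY].
have [Q /IHk[a [b [<- cha chb]]] [QP nPQ]] := ch.
have capQP : sub_le (cap_submod Q Y) (cap_submod P Y).
  by move=> x /mk_submodP[/QP Px Yx]; apply/mk_submodP.
have addQP : sub_le (add_submod Q Y) (add_submod P Y).
  by apply: add_submod_le; [move=> x /QP; apply: sub_addl | apply: sub_addr].
case: (pselect (sub_le (cap_submod P Y) (cap_submod Q Y))) => capPQ.
  exists a, b.+1; rewrite addnS; split=> //; first exact: chain_weaken cha.
  exists (add_submod Q Y) => //; split=> // addPQ; apply: nPQ => x Px.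
  have /addPQ/mk_submodP[y Qy [z Yz xE]] : x \in add_submod P Y by apply: sub_addl.
  rewrite xE rpredD//; apply: (@sub_capl _ _ _ Y).
  apply: capPQ; apply/mk_submodP; split=> //.
  have -> : z = x - y by rewrite xE addrAC subrr add0r.
  by apply: submodB => //; apply: QP.
by exists a.+1, b; rewrite addSn; split=> //; [exists (cap_submod Q Y) | exact: chain_weaken chb].
Qed.

Lemma len_le_add B Y A a b : sub_le B Y -> sub_le Y A ->
  len_le B Y a -> len_le Y A b -> len_le B A (a + b).
Proof.
move=> BY YA la lb k /(chain_split BY)[k1 [k2 [<- ch1 ch2]]].
apply: leq_add; first by apply: la; apply: chain_weaken ch1; apply: sub_capr.
by apply: lb; apply: chain_weaken ch2; apply: add_submod_le.
Qed.

End Length.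

(** * Comparing lengths through linear relations *)

Section LinearRelation.
Variables (M N : lmodType R).

(** A submodule of [M * N]. Relations replace maps because the comparisons below are defined only up
    to the choice of representatives or lifts. *)
Definition linear_rel (rho : M -> N -> Prop) : Prop :=
  rho 0 0 /\ forall a x x' y y',
    rho x y -> rho x' y' -> rho (a *: x + x') (a *: y + y').

Variable rho : M -> N -> Prop.
Hypothesis lrho : linear_rel rho.

Lemma linear_relB x x' y y' : rho x y -> rho x' y' -> rho (x - x') (y - y').
Proof.
move=> r r'; have [_ D] := lrho.
by have := D (-1) _ _ _ _ r' r; rewrite !scaleN1r addrC [- y' + _]addrC.
Qed.

Fact rel_image_closed0 (B : submodClosed N) (P : submodClosed M) :
  exists2 x, x \in P & exists2 b, b \in B & rho x (0 - b).
Proof.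
exists 0; rewrite ?rpred0//; exists 0; rewrite ?rpred0 ?subr0//; exact: lrho.1.
Qed.

Fact rel_image_closedD (B : submodClosed N) (P : submodClosed M) a y y' :
  (exists2 x, x \in P & exists2 b, b \in B & rho x (y - b)) ->
  (exists2 x, x \in P & exists2 b, b \in B & rho x (y' - b)) ->
  exists2 x, x \in P & exists2 b, b \in B & rho x (a *: y + y' - b).
Proof.
move=> [x Px [b Bb r]] [x' Px' [b' Bb' r']].
exists (a *: x + x'); first by rewrite rpredD ?rpredZ.
exists (a *: b + b'); first by rewrite rpredD ?rpredZ.
by rewrite opprD addrACA -scalerBr; apply: lrho.2.
Qed.

(** Saturating the image by [B] makes it a possible term of a chain above [B]. *)
Definition rel_image (B : submodClosed N) (P : submodClosed M) :=
  mk_submod (rel_image_closed0 B P) (@rel_image_closedD B P).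

Variables (B A : submodClosed M) (B' A' : submodClosed N).
Hypothesis tot : forall x, x \in A -> exists y, rho x y.
Hypothesis into : forall x y, x \in A -> rho x y -> y \in A'.
Hypothesis inj : forall x y, x \in A -> rho x y -> y \in B' -> x \in B.

Lemma chain_rel_image k P : sub_le P A -> chain B k P -> chain B' k (rel_image B' P).
Proof.
elim: k P => [|k IHk] P PA /=.
  move=> _ y By; apply/mk_submodP; exists 0; rewrite ?rpred0//.
  by exists y; rewrite // subrr; apply: lrho.1.
move=> [Q chQ [QP nPQ]]; have QA : sub_le Q A by move=> x /QP/PA.
exists (rel_image B' Q); first exact: IHk.
split=> [y /mk_submodP[x /QP Px rx]|im]; first by apply/mk_submodP; exists x.
apply: nPQ => x Px; have [y rxy] := tot (PA _ Px).
have /im/mk_submodP[x' Qx' [b Bb r]] : y \in rel_image B' P.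
  by apply/mk_submodP; exists x => //; exists 0; rewrite ?rpred0 ?subr0.
have rb : rho (x - x') b.
  by have := linear_relB rxy r; rewrite subKr.
have /(chain_le chQ) Qxx' : x - x' \in B.
  by apply: inj rb Bb; apply: submodB; [apply: PA | apply: QA].
by rewrite -(subrK x' x) rpredD.
Qed.

(** By [inj], sending [y] to [x] whenever [rho x y] is well defined modulo [B]. With [tot] and
    [into], this makes [A / B] a quotient of a submodule of [A' / B']. *)
Lemma len_le_rel L : sub_le B' A' -> len_le B' A' L -> len_le B A L.
Proof.
move=> BA lL k ch; apply: lL; apply: chain_weaken (chain_rel_image _ ch) => //.
move=> y /mk_submodP[x Ax [b /BA A'b r]].
by rewrite -(subrK b y) rpredD//; apply: into r.
Qed.

End LinearRelation.

Lemma linear_rel_eq (M : lmodType R) : linear_rel (fun x y : M => x = y).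
Proof. by split=> // a x x' y y' -> ->. Qed.

Lemma linear_rel_sym (M N : lmodType R) (rho : M -> N -> Prop) :
  linear_rel rho -> linear_rel (fun y x => rho x y).
Proof. by move=> [r0 rD]; split=> // a x x' y y'; apply: rD. Qed.

Lemma len_le_sub (M : lmodType R) (B A B' A' : submodClosed M) L :
  sub_le A A' -> sub_le B' A' -> (forall x, x \in A -> x \in B' -> x \in B) ->
  len_le B' A' L -> len_le B A L.
Proof.
move=> AA' BA' BB'; apply: (len_le_rel (@linear_rel_eq M)) => //.
- by move=> x _; exists x.
- by move=> x y /AA' A'x <-.
by move=> x y Ax <-; apply: BB'.
Qed.

Lemma the_natE (P : nat -> Prop) n : (forall k, P k -> k = n) -> P n ->
  the_nat P = Some n.
Proof.
move=> uP Pn; rewrite /the_nat; case: pselect => [exP|[]]; last by exists n.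
by rewrite (uP _ (projT2 (cid exP))).
Qed.

Lemma the_natP (P : nat -> Prop) n : the_nat P = Some n -> P n.
Proof.
by rewrite /the_nat; case: pselect => // exP [<-]; apply: projT2 (cid exP).
Qed.

Lemma submod_chainW (H : lmodType R) k :
  submod_chain H k -> chain (zero_submod H) k (full_submod H).
Proof.
move=> [F ltF]; apply: (@chain_weaken _ _ _ (F k)).
  by move=> x _; apply: mem_full_submod.
elim: k ltF => [|k IHk] ltF /=; first exact: zero_submod_le.
by exists (F k); [apply: IHk => i /ltnW; apply: ltF | apply: ltF].
Qed.

Lemma module_length_le (H : lmodType R) L :
  len_le (zero_submod H) (full_submod H) L ->
  exists2 k, module_length H = Some k & (k <= L)%N.
Proof.
move=> lL.
have bnd k : submod_chain H k -> (k <= L)%N by move=> /submod_chainW/lL.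
pose P k := `[< submod_chain H k >].
have exP : exists k, P k by exists 0%N; apply/asboolP; exists (fun=> zero_submod H).
have bndP k : P k -> (k <= L)%N by move=> /asboolP/bnd.
have [k Pk maxk] := ex_maxnP exP bndP.
have maxk' j : submod_chain H j -> (j <= k)%N by move=> ?; apply/maxk/asboolP.
exists k; last exact: bndP.
apply: the_natE; last by split=> //; apply/asboolP.
move=> j [chj maxj]; apply/eqP; rewrite eqn_leq maxk'// maxj//.
exact/asboolP.
Qed.

Section Quotient.
Variables (M : lmodType R) (N : submodClosed M).

Lemma quo_pi0 : quo_pi N 0 = 0.
Proof. by apply: (addrI (quo_pi N 0)); rewrite -quo_piD !addr0. Qed.

Lemma quo_piZ a x : quo_pi N (a *: x) = a *: quo_pi N x.
Proof. by rewrite -quo_scaleE. Qed.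

Lemma quo_pi_eq0 x : quo_pi N x = 0 <-> x \in N.
Proof. by rewrite -quo_pi0 quo_piE subr0. Qed.

End Quotient.

Section Subquotient.
Variables (M : lmodType R) (A B : submodClosed M).

(** Relates a representative to its class, so that [len_le_rel] carries lengths between the quotient
    type and submodules of [M]. *)
Definition subquo_rel (x : M) (h : subquotient A B) : Prop :=
  exists2 u : sub_type A, val u = x & quo_pi _ u = h.

Lemma subquo_linear : linear_rel subquo_rel.
Proof.
split; first by exists 0; rewrite ?raddf0 ?quo_pi0.
move=> a x x' y y' [u <- <-] [v <- <-]; exists (a *: u + v); first by rewrite linearP.
by rewrite quo_piD quo_piZ.
Qed.

Lemma subquo_rel_zero x h : subquo_rel x h -> h = 0 <-> x \in B.
Proof.
by move=> [u <- <-]; rewrite quo_pi_eq0; split=> [/mk_submodP//|Bu]; apply/mk_submodP.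
Qed.

Lemma subquo_rel_mem x h : subquo_rel x h -> x \in A.
Proof. by move=> [u <- _]; apply: valP. Qed.

Lemma subquo_rel_total x : x \in A -> exists h, subquo_rel x h.
Proof. by move=> Ax; exists (quo_pi _ (Sub x Ax)); exists (Sub x Ax); rewrite ?SubK. Qed.

Lemma subquo_rel_onto h : exists x, subquo_rel x h.
Proof. by exists (val (quo_repr h)); exists (quo_repr h) => //; rewrite quo_reprK. Qed.

End Subquotient.

Lemma subquotient_length_le (M : lmodType R) (A B : submodClosed M) L :
  sub_le B A -> len_le B A L ->
  exists2 k, module_length (subquotient A B) = Some k & (k <= L)%N.
Proof.
move=> BA lL; apply: module_length_le.
apply: (len_le_rel (linear_rel_sym (@subquo_linear _ A B))) BA lL => [h _|h x _|h x _].
- by have [x xh] := subquo_rel_onto h; exists x.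
- exact: subquo_rel_mem.
by move=> xh /(subquo_rel_zero xh)->; rewrite rpred0.
Qed.

End Chains.

(** * The Koszul complex on functions of subsets *)

(** The terms with [t < s] cancel those with [s < t]. The diagonal is a separate hypothesis because
    antisymmetry does not make it vanish when [V] has 2-torsion. *)
Lemma sum_antisym (n : nat) (V : zmodType) (f : 'I_n -> 'I_n -> V) :
  (forall s, f s s = 0) -> (forall s t, f s t = - f t s) ->
  \sum_s \sum_t f s t = 0.
Proof.
move=> f0 fN.
have lt0 : \sum_(s < n) \sum_(t : 'I_n | (t < s)%N) f s t =
      - \sum_(s < n) \sum_(t : 'I_n | (s < t)%N) f s t.
  rewrite (exchange_big_dep xpredT)//= -sumrN; apply: eq_bigr => s _.
  by rewrite -sumrN; apply: eq_bigr => t _; apply: fN.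
rewrite (eq_bigr (fun s : 'I_n => \sum_(t : 'I_n | (t < s)%N) f s t
                     + \sum_(t : 'I_n | (s < t)%N) f s t)).
  by rewrite big_split /= lt0 addNr.
move=> s _; rewrite (bigID (fun t : 'I_n => (t < s)%N)) /=; congr (_ + _).
rewrite (bigD1 s) ?ltnn//= f0 add0r; apply: eq_bigl => t.
by rewrite -leqNgt [RHS]ltn_neqAle eq_sym andbC.
Qed.

Section KoszulSets.
Variables (R : comNzRingType) (n : nat) (x : 'I_n -> R) (M : lmodType R).
Implicit Types (T : {set 'I_n}) (s u : 'I_n) (F : {set 'I_n} -> M).

Definition ksign T s : R := (-1) ^+ #|[set t in T | (t < s)%N]|.

(** The Koszul differential on functions of all subsets at once, so that [s |: T] needs no proof
    about its cardinality; [kext] and [kres] below pass to and from a fixed degree. *)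
Definition kdiff F T : M := \sum_(s | s \notin T) (ksign T s * x s) *: F (s |: T).

(** Exterior multiplication by the basis vector [e_s]. *)
Definition khomotopy s F T : M :=
  if s \in T then ksign (T :\ s) s *: F (T :\ s) else 0.

Lemma ksignU1 T u s : u \notin T -> ksign (u |: T) s = (-1) ^+ (u < s)%N * ksign T s.
Proof.
move=> uT; rewrite /ksign -exprD; congr (_ ^+ _).
case: (ltnP u s) => us.
  rewrite add1n (_ : [set t in _ | _] = u |: [set t in T | (t < s)%N]).
    by rewrite cardsU1 !inE (negPf uT).
  by apply/setP => t; rewrite !inE; case: eqP => //= ->.
rewrite add0n; congr #|pred_of_set _|.
by apply/setP => t; rewrite !inE; case: eqP => //= ->; rewrite ltnNge us (negPf uT).
Qed.

Lemma ksignsq T s : ksign T s * ksign T s = 1.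
Proof. by rewrite -expr2 sqrr_sign. Qed.

Lemma ksign_ltN s t : s != t -> (-1) ^+ (s < t)%N = - (-1) ^+ (t < s)%N :> R.
Proof.
rewrite -val_eqE /= neq_ltn; case: ltngtP => //= _ _; rewrite expr0 expr1// opprK//.
Qed.

(** Inserting [s] then [t] has the opposite sign to inserting [t] then [s], since exactly one of the
    two lies below the other; the double sum is antisymmetric. *)
Lemma kdiffK F T : kdiff (kdiff F) T = 0.
Proof.
pose f s t : M := if [&& s \notin T, t \notin T & s != t] then
  (ksign T s * x s * (ksign (s |: T) t * x t)) *: F (t |: (s |: T)) else 0.
rewrite -[RHS](@sum_antisym _ _ f); first last.
- move=> s t; rewrite /f eq_sym [in RHS]andbCA; case: ifP; last by rewrite oppr0.
  move=> /and3P[sT tT ts].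
  rewrite setUCA !ksignU1// -scaleNr; congr (_ *: _).
  by rewrite (ksign_ltN ts); ring.
- by move=> s; rewrite /f eqxx !andbF.
rewrite [LHS]big_mkcond; apply: eq_bigr => s _.
case: ifP => sT; last by rewrite big1// => t _; rewrite /f sT.
rewrite scaler_sumr big_mkcond; apply: eq_bigr => t _.
rewrite /f sT in_setU1 negb_or eq_sym andbC /=.
by case: ifP => // _; rewrite scalerA.
Qed.

(** If [s] is outside [T], only the index [s] of the first sum survives. If [s] is in [T], the index
    [s] of the second sum gives the right-hand side, and every other index cancels between the two
    sums by anticommutation. *)
Lemma khomotopyE s F T :
  kdiff (khomotopy s F) T + khomotopy s (kdiff F) T = x s *: F T.
Proof.
rewrite {2}/khomotopy; case: ifP => sT; last first.
  rewrite addr0 /kdiff (bigD1 s) ?sT//= big1 ?addr0 => [|u /andP[uT us]].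
    rewrite /khomotopy setU11 setU1K ?sT// scalerA.
    by rewrite mulrAC ksignsq mul1r.
  by rewrite /khomotopy in_setU1 eq_sym (negPf us) sT scaler0.
set T' := T :\ s; have sT' : s \notin T' by rewrite !inE eqxx.
have TE : T = s |: T' by rewrite setD1K.
rewrite [in X in _ + X]/kdiff (bigD1 s)//= scalerDr scalerA mulrA ksignsq mul1r -TE.
rewrite addrCA -[RHS]addr0; congr (_ + _).
rewrite scaler_sumr /kdiff.
rewrite [X in _ + X](eq_bigl (fun u => u \notin T)); last first.
  by move=> u; rewrite TE !inE negb_or andbC; case: (u == s).
rewrite -big_split big1//= => u uT.
have us : u != s by apply: contraNneq uT => ->.
have uT' : u \notin T' by rewrite !inE negb_and uT orbT.
have usT : (u |: T) :\ s = u |: T'.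
  by apply/setP => t; rewrite !inE; case: (eqVneq t u) => [->|_]; rewrite ?us.
rewrite /khomotopy in_setU1 sT orbT usT !scalerA -scalerDl.
rewrite TE !ksignU1// (ksign_ltN us).
have bb : (-1) ^+ (s < u)%N * (-1) ^+ (s < u)%N = 1 :> R by rewrite -expr2 sqrr_sign.
set b : R := _ ^+ _ in bb *.
have -> : b * ksign T' u * x u * (- b * ksign T' s) + ksign T' s * (ksign T' u * x u)
        = (1 - b * b) * (ksign T' s * (ksign T' u * x u)) by ring.
by rewrite bb subrr mul0r scale0r.
Qed.

Definition kext i (f : koszul n M i) T : M := oapp f 0 (insub T).

Lemma kext_val i (f : koszul n M i) (S : subsets n i) : kext f (val S) = f S.
Proof. by rewrite /kext valK. Qed.

Lemma kext_sub i (f : koszul n M i) T (cT : #|T| == i) : kext f T = f (Sub T cT).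
Proof. by rewrite /kext insubT. Qed.

Lemma kext_out i (f : koszul n M i) T : #|T| != i -> kext f T = 0.
Proof. by move=> cT; rewrite /kext insubN. Qed.

Definition kres i F : koszul n M i := [ffun S => F (val S)].

Lemma kext_res i F : (forall T, #|T| != i -> F T = 0) -> kext (kres i F) =1 F.
Proof.
move=> F0 T; case: (boolP (#|T| == i)) => cT; last by rewrite kext_out// F0.
by rewrite kext_sub ffunE.
Qed.

Lemma koszul_diffE i (f : koszul n M i.+1) (T : subsets n i) :
  koszul_diff x M i f T = kdiff (kext f) (val T).
Proof.
rewrite /kdiff ffunE (exchange_big_dep xpredT)//= [RHS]big_mkcond.
apply: eq_bigr => s _; case: ifP => sT; last first.
  rewrite big_pred0// => S; apply/negP => /andP[_ /eqP ST].
  by move: sT; rewrite -ST !inE eqxx.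
have cS : #|s |: val T| == i.+1 by rewrite cardsU1 sT (eqP (valP T)).
rewrite (big_pred1 (Sub (s |: val T) cS : subsets n i.+1)); last first.
  move=> S /=; rewrite -[X in _ = X]val_eqE /=; apply/andP/eqP => [[sS /eqP<-]|->].
    by rewrite setD1K.
  by rewrite setU11 setU1K.
rewrite kext_sub; congr (((-1) ^+ #|pred_of_set _| * _) *: _).
by apply/setP => t; rewrite !inE; case: eqP => //= ->; rewrite ltnn andbF.
Qed.

Lemma kext_diff i (f : koszul n M i.+1) :
  kext (koszul_diff x M i f) =1 kdiff (kext f).
Proof.
move=> T; case: (boolP (#|T| == i)) => cT.
  by rewrite kext_sub koszul_diffE SubK.
rewrite kext_out// /kdiff big1// => s sT.
by rewrite kext_out ?scaler0// cardsU1 sT.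
Qed.

Lemma kdiff_ext F G : F =1 G -> kdiff F =1 kdiff G.
Proof. by move=> FG T; apply: eq_bigr => s _; rewrite FG. Qed.

Lemma koszul_diffK i (f : koszul n M i.+2) :
  koszul_diff x M i (koszul_diff x M i.+1 f) = 0.
Proof.
apply/ffunP => T; rewrite koszul_diffE (kdiff_ext (kext_diff f)) kdiffK ffunE//.
Qed.

Definition khom s i (f : koszul n M i) : koszul n M i.+1 := kres i.+1 (khomotopy s (kext f)).

Lemma kext_hom s i (f : koszul n M i) : kext (khom s f) =1 khomotopy s (kext f).
Proof.
apply: kext_res => T cT; rewrite /khomotopy; case: ifP => // sT.
rewrite kext_out ?scaler0//; apply: contraNneq cT => <-.
by rewrite [in #|_|](cardsD1 s) sT.
Qed.

Lemma khomE s i (f : koszul n M i.+1) :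
  koszul_diff x M i.+1 (khom s f) + khom s (koszul_diff x M i f) = x s *: f.
Proof.
apply/ffunP => T; rewrite [RHS]ffunE [LHS]ffunE -!kext_val -khomotopyE; congr (_ + _).
  by rewrite kext_diff; apply: kdiff_ext; apply: kext_hom.
rewrite kext_hom /khomotopy; case: ifP => // _; rewrite kext_diff//.
Qed.

End KoszulSets.

(** * Length of the Koszul homology of a subquotient *)

Section KoszulLength.
Variables (R : comNzRingType) (n : nat) (x : 'I_n -> R).
Notation kd M p := (koszul_diff x M p).

Lemma koszul_choice (M : lmodType R) p (P : subsets n p -> M -> Prop) :
  (forall S, exists u, P S u) -> exists f : koszul n M p, forall S, P S (f S).
Proof. by move=> /choice[f Pf]; exists [ffun S => f S] => S; rewrite ffunE. Qed.

Lemma koszul0E (M : lmodType R) p S : (0 : koszul n M p) S = 0.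
Proof. by rewrite ffunE. Qed.

Lemma koszulDE (M : lmodType R) p (f g : koszul n M p) S : (f + g) S = f S + g S.
Proof. by rewrite ffunE. Qed.

Lemma koszulBE (M : lmodType R) p (f g : koszul n M p) S : (f - g) S = f S - g S.
Proof. by rewrite 2!ffunE. Qed.

Lemma koszulZE (M : lmodType R) p a (f : koszul n M p) S : (a *: f) S = a *: f S.
Proof. by rewrite ffunE. Qed.

Definition koszulE := (koszul0E, koszulDE, koszulBE, koszulZE).

(** The differential forms linear combinations of values with coefficients independent of the
    module, so it preserves any submodule of [M * N]. *)
Lemma koszul_diff_rel (M N : lmodType R) (rho : M -> N -> Prop) p
    (f : koszul n M p.+1) (g : koszul n N p.+1) :
  linear_rel rho -> (forall S, rho (f S) (g S)) ->
  forall T, rho (kd M p f T) (kd N p g T).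
Proof.
move=> [r0 rD] rfg T; rewrite !ffunE.
have rA u u' v v' : rho u v -> rho u' v' -> rho (u + u') (v + v').
  by move=> r r'; rewrite -[u]scale1r -[v]scale1r; apply: rD.
apply: (big_ind2 rho) => // [? ? ? ?|S _]; first exact: rA.
apply: (big_ind2 rho) => // [? ? ? ?|s _]; first exact: rA.
by rewrite -[_ *: f _]addr0 -[_ *: g _]addr0; apply: rD.
Qed.

Lemma linear_rel_mem (M : lmodType R) (A : submodClosed M) :
  linear_rel (fun u _ : M => u \in A).
Proof. by split=> [|a u u' _ _ Au Au']; rewrite ?rpred0// rpredD ?rpredZ. Qed.

Lemma koszul_diff_mem (M : lmodType R) (A : submodClosed M) p (f : koszul n M p.+1) :
  (forall S, f S \in A) -> forall T, kd M p f T \in A.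
Proof. by move=> Af; apply: (koszul_diff_rel (g := f) (linear_rel_mem A)). Qed.

Lemma khom_mem (M : lmodType R) (A : submodClosed M) s p (f : koszul n M p) :
  (forall S, f S \in A) -> forall T, khom s f T \in A.
Proof.
move=> Af T; rewrite ffunE /khomotopy; case: ifP => _; last exact: rpred0.
apply: rpredZ; rewrite /kext; case: insubP => [S _ _|_] /=; [exact: Af | exact: rpred0].
Qed.

Section Pair.
Variables (M : lmodType R) (A B : submodClosed M) (p : nat).
Implicit Types (f g : koszul n M p.+1).

Let cycle f := (forall S, f S \in A) /\ (forall T, kd M p f T \in B).
Let bound f := exists2 g : koszul n M p.+2,
  forall S, g S \in A & forall S, (f - kd M p.+1 g) S \in B.

Fact koszul_cycles_closed0 : cycle 0.
Proof. by split=> S; rewrite ?linear0 koszulE rpred0. Qed.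

Fact koszul_cycles_closedD a f g : cycle f -> cycle g -> cycle (a *: f + g).
Proof.
move=> [Af Bf] [Ag Bg]; split=> S; first by rewrite !koszulE rpredD ?rpredZ.
by rewrite linearP !koszulE rpredD ?rpredZ.
Qed.

(* The (p+1)-cycles and boundaries of the Koszul complex on A / B, lifted to M. *)
Definition koszul_cycles : submodClosed (koszul n M p.+1) :=
  mk_submod koszul_cycles_closed0 koszul_cycles_closedD.

Fact koszul_bounds_closed0 : bound 0.
Proof. by exists 0 => S; [|rewrite linear0 subr0]; rewrite koszul0E rpred0. Qed.

Fact koszul_bounds_closedD a f g : bound f -> bound g -> bound (a *: f + g).
Proof.
move=> [f' Af' Bf] [g' Ag' Bg]; exists (a *: f' + g') => S.
  by rewrite !koszulE rpredD ?rpredZ.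
rewrite linearP opprD addrACA -scalerBr koszulDE koszulZE.
by apply: rpredD => //; apply: rpredZ.
Qed.

Definition koszul_bounds : submodClosed (koszul n M p.+1) :=
  mk_submod koszul_bounds_closed0 koszul_bounds_closedD.

Lemma koszul_cyclesP f : reflect (cycle f) (f \in koszul_cycles).
Proof. exact: mk_submodP. Qed.

Lemma koszul_boundsP f : reflect (bound f) (f \in koszul_bounds).
Proof. exact: mk_submodP. Qed.

Lemma koszul_bounds_cycles : sub_le B A -> sub_le koszul_bounds koszul_cycles.
Proof.
move=> BA f /koszul_boundsP[g Ag Bf]; apply/koszul_cyclesP.
rewrite -(subrK (kd M p.+1 g) f); split=> S.
  rewrite koszulDE; apply: rpredD; [exact/BA/Bf | exact: koszul_diff_mem].
by rewrite linearD koszul_diffK addr0 koszul_diff_mem.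
Qed.

(** Bounds the length of [H_(p+1)(x; A / B)]: the index [p] stands for degree [p.+1], so only
    positive degrees are considered. *)
Definition klen (L : nat) : Prop := len_le koszul_bounds koszul_cycles L.

(** No subset of ['I_n] has [p.+1] elements, so there is no entry to check. *)
Lemma klen_vanish : (n <= p)%N -> klen 0.
Proof.
move=> np; apply: len_le0 => f _; apply/koszul_boundsP; exists 0 => S.
  by rewrite koszulE rpred0.
have := max_card (val S); rewrite (eqP (valP S)) card_ord => pn.
by have := leq_trans pn np; rewrite ltnn.
Qed.

End Pair.

Lemma klen_refl (M : lmodType R) (A : submodClosed M) p : klen A A p 0.
Proof.
apply: len_le0 => f /koszul_cyclesP[Af _]; apply/koszul_boundsP; exists 0 => S.
  by rewrite koszul0E rpred0.
by rewrite linear0 subr0.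
Qed.

(** Exactness of [H(B / C) -> H(A / C) -> H(A / B)] in the middle. The submodule [Y] lifts the image
    of the first map, and the cycles modulo [Y] embed in the third term. *)
Lemma klen_add (M : lmodType R) (A B C : submodClosed M) p a b :
  sub_le C B -> sub_le B A ->
  klen B C p a -> klen A B p b -> klen A C p (a + b).
Proof.
move=> CB BA la lb; set Y := add_submod (koszul_bounds A C p) (koszul_cycles B C p).
have CA : sub_le C A by move=> y /CB/BA.
have BCAC : sub_le (koszul_bounds B C p) (koszul_bounds A C p).
  by move=> f /koszul_boundsP[g Bg Cf]; apply/koszul_boundsP; exists g => // S; apply: BA.
apply: (@len_le_add _ _ _ Y); first exact: sub_addl.
- apply: add_submod_le; first exact: koszul_bounds_cycles.
  by move=> f /koszul_cyclesP[Bf Cf]; apply/koszul_cyclesP; split=> // S; apply: BA.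
(* An element [y] of [Y] is related to the cycles [z] of [B / C] that represent its class. *)
- apply: (@len_le_rel _ _ _ (fun y z => z \in koszul_cycles B C p /\
       y - z \in koszul_bounds A C p) _ _ _ _ _ _ _ _ _ (koszul_bounds_cycles CB) la).
  + split=> [|r y y' z z' [cz by_] [cz' by_']]; first by rewrite subr0 !rpred0.
    rewrite opprD addrACA -scalerBr.
    by split; apply: rpredD => //; apply: rpredZ.
  + by move=> y /mk_submodP[b' bb [z cz ->]]; exists z; rewrite addrK.
  + by move=> y z _ [].
  by move=> y z _ [_ bb] /BCAC bz; rewrite -(subrK z y) rpredD.
apply: len_le_sub lb; last 1 first.
- move=> f /koszul_cyclesP[Af Cf] /koszul_boundsP[g Ag Bf].
  apply/mk_submodP; exists (kd M p.+1 g).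
    by apply/koszul_boundsP; exists g => // S; rewrite subrr koszulE rpred0.
  exists (f - kd M p.+1 g); last by rewrite addrC subrK.
  by apply/koszul_cyclesP; split=> // S; rewrite linearB /= koszul_diffK subr0.
- by move=> f /koszul_cyclesP[Af Cf]; apply/koszul_cyclesP; split=> // S; apply: CB.
exact: koszul_bounds_cycles.
Qed.

Lemma linear_rel_koszul (M N : lmodType R) (rho : M -> N -> Prop) p : linear_rel rho ->
  linear_rel (fun (f : koszul n M p) (g : koszul n N p) => forall S, rho (f S) (g S)).
Proof.
move=> [r0 rD]; split=> [S|a f f' g g' r r' S]; first by rewrite !koszul0E.
by rewrite !koszulDE !koszulZE; exact: (rD _ _ _ _ _ (r S) (r' S)).
Qed.

(** The relation induces an isomorphism from [A] modulo [B] onto [A' / B'] and is used entry by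
    entry. Surjectivity serves to lift the chain that witnesses a boundary. *)
Lemma klen_rel (M N : lmodType R) (rho : M -> N -> Prop)
    (A B : submodClosed M) (A' B' : submodClosed N) p L :
  linear_rel rho -> sub_le B' A' ->
  (forall u, u \in A -> exists v, rho u v) ->
  (forall v, v \in A' -> exists2 u, u \in A & rho u v) ->
  (forall u v, u \in A -> rho u v -> v \in A') ->
  (forall u v, u \in A -> rho u v -> u \in B <-> v \in B') ->
  klen A' B' p L -> klen A B p L.
Proof.
move=> lr BA' tot onto into inj lL.
apply: (len_le_rel (linear_rel_koszul p.+1 lr) _ _ _ (koszul_bounds_cycles BA') lL).
- move=> f /koszul_cyclesP[Af _].
  by apply: (koszul_choice (P := fun S => rho (f S))) => S; apply: tot.
- move=> f g /koszul_cyclesP[Af Bf] r; apply/koszul_cyclesP.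
  split=> S; first exact: into (r S).
  apply/(inj (kd M p f S)); [exact: koszul_diff_mem | exact: koszul_diff_rel | exact: Bf].
- move=> f g /koszul_cyclesP[Af Bf] r /koszul_boundsP[g' Ag' Bg].
  have [f' rf'] : exists f' : koszul n M p.+2, forall S, f' S \in A /\ rho (f' S) (g' S).
    apply: (koszul_choice (P := fun S u => u \in A /\ rho u (g' S))) => S.
    by have [u Au ru] := onto _ (Ag' S); exists u.
  have Adf' : forall S, kd M p.+1 f' S \in A by apply: koszul_diff_mem => S; have [] := rf' S.
  apply/koszul_boundsP; exists f' => S; first by have [] := rf' S.
  have ES : rho ((f - kd M p.+1 f') S) ((g - kd N p.+1 g') S).
    rewrite !koszulBE; apply: (linear_relB lr) => //.
    exact: koszul_diff_rel lr (fun S => (rf' S).2) S.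
  by apply/(inj _ _ _ ES) => //; rewrite koszulBE; exact: submodB.
Qed.

(** * Acyclic quotients and the connecting map of Koszul homology *)

Section Connecting.
Variables (M N : lmodType R) (f : {linear M -> N}) (T : submodClosed M).

Fact map_submod_closed0 : exists2 t, t \in T & f t = 0.
Proof. by exists 0; rewrite ?rpred0 ?linear0. Qed.

Fact map_submod_closedD a y y' : (exists2 t, t \in T & f t = y) ->
  (exists2 t, t \in T & f t = y') -> exists2 t, t \in T & f t = a *: y + y'.
Proof.
by move=> [t Tt <-] [t' Tt' <-]; exists (a *: t + t'); rewrite ?linearP// rpredD ?rpredZ.
Qed.

Definition map_submod : submodClosed N := mk_submod map_submod_closed0 map_submod_closedD.

Lemma map_submod_image : sub_le map_submod (image f).
Proof. by move=> y /mk_submodP[t _ <-]; apply/mk_submodP; exists t. Qed.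

Lemma linear_rel_map : linear_rel (fun y t => y = f t).
Proof. by split=> [|a y y' t t' -> ->]; rewrite ?linear0 ?linearP. Qed.

End Connecting.

(** As [p] stands for degree [p.+1], vanishing is asked in positive degrees only; [H_0] may be
    nonzero. *)
Definition koszul_acyclic (M : lmodType R) (A B : submodClosed M) : Prop :=
  forall p, sub_le (koszul_cycles A B p) (koszul_bounds A B p).

Lemma koszul_acyclic_trans (M : lmodType R) (A B C : submodClosed M) :
  sub_le C B -> sub_le B A ->
  koszul_acyclic A B -> koszul_acyclic B C -> koszul_acyclic A C.
Proof.
move=> CB BA acAB acBC p f /koszul_cyclesP[Af Cf].
have /acAB/koszul_boundsP[g Ag Bf] : f \in koszul_cycles A B p.
  by apply/koszul_cyclesP; split=> // S; apply: CB.
have /acBC/koszul_boundsP[g' Bg' Cfg] : f - kd M p.+1 g \in koszul_cycles B C p.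
  by apply/koszul_cyclesP; split=> // S; rewrite linearB /= koszul_diffK subr0.
apply/koszul_boundsP; exists (g + g') => S.
  by rewrite koszulE; apply: rpredD => //; apply: BA.
by rewrite linearD opprD addrA.
Qed.

(* Multiplication by x_s is bijective on A / B and null-homotopic. *)
Lemma koszul_acyclic_bij (M : lmodType R) (A B : submodClosed M) s : sub_le B A ->
  (forall a, a \in A -> x s *: a \in B -> a \in B) ->
  (forall a, a \in A -> exists2 a', a' \in A & a - x s *: a' \in B) ->
  koszul_acyclic A B.
Proof.
move=> BA injx surjx p f /koszul_cyclesP[Af Bf].
have [g gP] : exists g : koszul n M p.+1, forall S, g S \in A /\ f S - x s *: g S \in B.
  apply: (koszul_choice (P := fun S u => u \in A /\ f S - x s *: u \in B)) => S.
  by have [u Au Bu] := surjx _ (Af S); exists u.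
have Ag S : g S \in A by have [] := gP S.
have Bg S : (f - x s *: g) S \in B by rewrite koszulBE koszulZE; have [] := gP S.
have Bdg T : kd M p g T \in B.
  apply: injx; first exact: koszul_diff_mem.
  have -> : x s *: kd M p g T = kd M p f T - kd M p (f - x s *: g) T.
    by rewrite -koszulBE -linearB subKr linearZ koszulZE.
  by apply: submodB => //; apply: koszul_diff_mem.
apply/koszul_boundsP; exists (khom s g); first exact: khom_mem.
move=> S; have -> : f - kd M p.+1 (khom s g) = (f - x s *: g) + khom s (kd M p g).
  by rewrite -(khomE x s g) opprD addrA subrK.
by rewrite koszulDE; apply: rpredD => //; apply: khom_mem.
Qed.

(** The exact sequence [0 -> ker f / (ker f /\ T) -> M / T -> f(M) / f(T) -> 0] has a connecting map
    from degree [p + 2] to degree [p + 1], which is onto because the middle term is acyclic. *)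
Lemma klen_connecting (M N : lmodType R) (f : {linear M -> N}) (T : submodClosed M) p L :
  koszul_acyclic (full_submod M) T ->
  klen (image f) (map_submod f T) p.+1 L -> klen (kernel f) (cap_submod (kernel f) T) p L.
Proof.
(* The connecting map read backwards: write the cycle [c] as the boundary of [e] modulo [T], then
   push [e] forward by [f]. *)
move=> acT lL; pose rho (c : koszul n M p.+1) (y : koszul n N p.+2) :=
  exists e : koszul n M p.+2,
    (forall S, (c - kd M p.+1 e) S \in T) /\ (forall S, y S = f (e S)).
have fdiff q (u : koszul n M q.+1) (v : koszul n N q.+1) : (forall S, v S = f (u S)) ->
    forall S, kd N q v S = f (kd M q u S).
  by move=> vu S; apply: (koszul_diff_rel (linear_rel_map f)).
have lrho : linear_rel rho.
  split=> [|a c c' y y' [e [Te ye]] [e' [Te' ye']]].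
    by exists 0; rewrite linear0 subr0; split=> S; rewrite !koszul0E ?rpred0 ?linear0.
  exists (a *: e + e'); split=> S; last first.
    by rewrite !koszulDE !koszulZE ye ye' linearP.
  rewrite linearP opprD addrACA -scalerBr koszulDE koszulZE.
  by apply: rpredD => //; apply: rpredZ.
have kerP u : reflect (f u = 0) (u \in kernel f) by apply: mk_submodP.
apply: (len_le_rel lrho _ _ _ (koszul_bounds_cycles (@map_submod_image _ _ f T)) lL).
- move=> c /koszul_cyclesP[_ dc].
  have /acT/koszul_boundsP[e _ Te] : c \in koszul_cycles (full_submod M) T p.
    apply/koszul_cyclesP; split=> S; first exact: mem_full_submod.
    by have /mk_submodP[] := dc S.
  by exists [ffun S => f (e S)]; exists e; split=> // S; rewrite ffunE.
- move=> c y /koszul_cyclesP[fc dc] [e [Te ye]]; apply/koszul_cyclesP; split=> S.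
    by apply/mk_submodP; exists (e S).
  rewrite (fdiff _ e y)//; apply/mk_submodP; exists (- ((c - kd M p.+1 e) S)).
    by rewrite -scaleN1r rpredZ.
  by have /kerP fcS := fc S; rewrite koszulBE opprB linearB /= fcS subr0.
move=> c y /koszul_cyclesP[fc dc] [e [Te ye]] /koszul_boundsP[y' fy' Ty].
have [e' ey'] : exists e' : koszul n M p.+3, forall S, y' S = f (e' S).
  apply: (koszul_choice (P := fun S u => y' S = f u)) => S.
  by have /mk_submodP[u <-] := fy' S; exists u.
have [t tP] : exists t : koszul n M p.+2, forall S, t S \in T /\
    (y - kd N p.+2 y') S = f (t S).
  apply: (koszul_choice (P := fun S u => u \in T /\ (y - kd N p.+2 y') S = f u)) => S.
  by have /mk_submodP[u Tu <-] := Ty S; exists u.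
(* Subtracting a lift of the boundary and a lift in [T] of the remainder brings [e] into the kernel
   of [f], and changes its differential only by an element of [T]. *)
pose g := e - kd M p.+2 e' - t.
have kg S : g S \in kernel f.
  apply/kerP; rewrite /g 2!koszulBE !linearB -ye -(fdiff _ _ _ ey').
  by rewrite -(tP S).2 koszulBE subrr.
apply/koszul_boundsP; exists g => // S; apply/mk_submodP; split.
  by rewrite koszulBE; apply: submodB; [exact: fc | exact: koszul_diff_mem].
have -> : c - kd M p.+1 g = (c - kd M p.+1 e) + kd M p.+1 t.
  have -> : kd M p.+1 g = kd M p.+1 e - kd M p.+1 t.
    by rewrite (linearB (kd M p.+1)) (linearB (kd M p.+1)) [X in _ - X - _]koszul_diffK subr0.
  by rewrite opprB addrA addrAC.
rewrite koszulDE; apply: rpredD => //; apply: koszul_diff_mem => S'.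
by have [] := tP S'.
Qed.

Lemma koszul_homology_length_le (M : lmodType R) p L :
  klen (full_submod M) (zero_submod M) p L ->
  exists2 k, module_length (koszul_homology x M p.+1) = Some k & (k <= L)%N.
Proof.
move=> lL; apply: subquotient_length_le => [f /mk_submodP[g <-]|].
  by apply/mk_submodP; apply: koszul_diffK.
apply: len_le_sub lL.
- move=> f /mk_submodP df; apply/koszul_cyclesP; split=> S; first exact: mem_full_submod.
  by rewrite df koszul0E rpred0.
- exact/koszul_bounds_cycles/zero_submod_le.
move=> f _ /koszul_boundsP[g _ fg]; apply/mk_submodP; exists g; apply/ffunP => S.
have := fg S; rewrite mem_zero_submod koszulBE subr_eq0 => /eqP//.
Qed.

End KoszulLength.

(** * Chain conditions and finite length *)

(** Otherwise choice gives a successor function, whose iterates from [x0] form an infinite chain. *)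
Lemma ex_maximal (T : Type) (P : T -> Prop) (lt : T -> T -> Prop) (x0 : T) : P x0 ->
  (forall F : nat -> T, (forall i, P (F i)) -> ~ forall i, lt (F i) (F i.+1)) ->
  exists2 x, P x & forall y, P y -> ~ lt x y.
Proof.
move=> Px0 nochain; apply: contrapT => nex.
have step x : exists y, P x -> P y /\ lt x y.
  case: (pselect (P x)) => Px; last by exists x.
  apply: contrapT => nstep; apply: nex; exists x => // y Py ltxy.
  by apply: nstep; exists y.
have [f fP] := choice step.
have PF i : P (iter i f x0) by elim: i => //= i /fP[].
by apply: (nochain (fun i => iter i f x0)) => // i; have [] := fP _ (PF i).
Qed.

Lemma descending_le (R : comNzRingType) (M : lmodType R) (F : nat -> submodClosed M) :
  (forall i, sub_le (F i.+1) (F i)) -> forall i j, (i <= j)%N -> sub_le (F j) (F i).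
Proof.
move=> dF i; elim=> [|j IHj]; first by rewrite leqn0 => /eqP->.
rewrite leq_eqVlt => /predU1P[->//|]; rewrite ltnS => /IHj Fji u /dF; exact: Fji.
Qed.

Section Noetherian.
Variable R : comNzRingType.
Hypothesis noethR : noetherian R.

Lemma noetherian_acc (F : nat -> submodClosed R^o) :
  (forall i, sub_le (F i) (F i.+1)) -> exists k, forall i, sub_le (F i) (F k).
Proof.
move=> aF.
have mono i j : (i <= j)%N -> sub_le (F i) (F j).
  elim: j => [|j IHj]; first by rewrite leqn0 => /eqP->.
  by rewrite leq_eqVlt => /predU1P[->//|]; rewrite ltnS => /IHj Fij u /Fij/aF.
have U0 : exists i, 0 \in F i by exists 0%N; rewrite rpred0.
have UD a (u v : R^o) : (exists i, u \in F i) -> (exists i, v \in F i) ->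
    exists i, a *: u + v \in F i.
  move=> [i Fu] [j Fv]; exists (maxn i j); apply: rpredD.
    by apply: rpredZ; apply: (mono _ _ (leq_maxl i j)).
  exact: (mono _ _ (leq_maxr i j)).
have [s sU] := noethR (mk_submod U0 UD).
have [k Fk] : exists k, forall u, u \in s -> u \in F k.
  have {sU} : forall u, u \in s -> exists i, u \in F i.
    move=> u us; have /mk_submodP// : u \in mk_submod U0 UD.
    by rewrite -sU; apply/mk_submodP => N; apply.
  elim: s => [|u s IHs] sF; first by exists 0%N.
  have [|i Fi] := IHs; first by move=> v vs; apply: sF; rewrite inE vs orbT.
  have [j Fj] := sF u (mem_head _ _); exists (maxn i j) => v.
  rewrite inE => /predU1P[->|/Fi Fiv]; first exact: (mono _ _ (leq_maxr i j)).
  exact: (mono _ _ (leq_maxl i j)).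
exists k => i u Fu; have : u \in mk_submod U0 UD by apply/mk_submodP; exists i.
by rewrite -sU => /mk_submodP; apply.
Qed.

Lemma noetherian_maximal (P : submodClosed R^o -> Prop) I0 : P I0 ->
  exists2 I, P I & forall J, P J -> sub_le I J -> sub_le J I.
Proof.
move=> PI0; have [F _ ltF|I PI maxI] := ex_maximal (lt := @sub_lt _ _) PI0.
  have [k Fk] := noetherian_acc (fun i => (ltF i).1).
  by have [_ []] := ltF k; apply: Fk.
by exists I => // J PJ IJ; apply: contrapT => nJI; apply: (maxI J).
Qed.
End Noetherian.

Section Artinian.
Variables (R : comNzRingType).

Lemma artinian_minimal (M : lmodType R) (P : submodClosed M -> Prop) N0 :
  artinian M -> P N0 ->
  exists2 N, P N & forall N', P N' -> sub_le N' N -> sub_le N N'.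
Proof.
move=> artM PN0; have [F _ ltF|N PN minN] := ex_maximal (lt := fun A B => sub_lt B A) PN0.
  have [k Fk] := artM F (fun i => (ltF i).1).
  by have [_ []] := ltF k => u; rewrite (Fk k.+1) ?leqnSn.
by exists N => // N' PN' N'N; apply: contrapT => nN; apply: (minN N').
Qed.

(** Induction on a list of coordinates outside which every [F i] vanishes. For a coordinate [j], the
    values at [j] stabilise in [M], and the functions vanishing at [j] stabilise by induction. *)
Lemma artinian_ffun (I : finType) (M : lmodType R) : artinian M -> artinian {ffun I -> M}.
Proof.
move=> artM.
suff stab (s : seq I) (F : nat -> submodClosed {ffun I -> M}) :
    (forall i, sub_le (F i.+1) (F i)) ->
    (forall i f j, f \in F i -> j \notin s -> f j = 0) ->
    exists k, forall i, (k <= i)%N -> sub_le (F k) (F i).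
  move=> F dF; have [i f j _|k Fk] := stab (enum I) F dF; first by rewrite mem_enum.
  exists k => i ki f; apply/idP/idP; last exact: Fk.
  exact: descending_le.
elim: s F => [|j s IHs] F dF F0.
  exists 0%N => i _ f Ff; have -> : f = 0 by apply/ffunP => j; rewrite (F0 _ _ _ Ff) ?ffunE.
  exact: rpred0.
have ev0 (N : submodClosed {ffun I -> M}) : exists2 f : {ffun I -> M}, f \in N & f j = 0.
  by exists 0; rewrite ?ffunE ?rpred0.
have evD (N : submodClosed {ffun I -> M}) a u v : (exists2 f : {ffun I -> M}, f \in N & f j = u) ->
    (exists2 f : {ffun I -> M}, f \in N & f j = v) ->
    exists2 f : {ffun I -> M}, f \in N & f j = a *: u + v.
  move=> [f Nf <-] [g Ng <-]; exists (a *: f + g); last by rewrite !ffunE.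
  by rewrite rpredD ?rpredZ.
pose ev (N : submodClosed {ffun I -> M}) := mk_submod (ev0 N) (evD N).
have [i|k1 Ek] := artM (fun i => ev (F i)).
  by move=> u /mk_submodP[f Ff fu]; apply/mk_submodP; exists f => //; apply: dF.
have z0 : (0 : {ffun I -> M}) j = 0 by rewrite ffunE.
have zD a (f g : {ffun I -> M}) : f j = 0 -> g j = 0 -> (a *: f + g) j = 0.
  by move=> f0 g0; rewrite !ffunE f0 g0 scaler0 addr0.
pose Z := mk_submod z0 zD.
have [i|i f l /mk_submodP[Ff /mk_submodP fj] ls|k2 Zk] := IHs (fun i => cap_submod (F i) Z).
- by move=> f /mk_submodP[Ff Zf]; apply/mk_submodP; split=> //; apply: dF.
- case: (eqVneq l j) => [->//|lj].
  by apply: (F0 _ _ _ Ff); rewrite inE negb_or lj.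
exists (maxn k1 k2) => i; rewrite geq_max => /andP[k1i k2i] f Ff.
have : f j \in ev (F i).
  rewrite (Ek i)// -(Ek (maxn k1 k2)) ?leq_maxl//; apply/mk_submodP; exists f => //.
move=> /mk_submodP[g Fg gj]; rewrite -(subrK g f); apply: rpredD => //.
have le2 : sub_le (F (maxn k1 k2)) (F k2) by apply: descending_le; rewrite ?leq_maxr.
have : f - g \in cap_submod (F k2) Z.
  apply/mk_submodP; split; last by apply/mk_submodP; rewrite 2!ffunE gj subrr.
  by apply: submodB; [apply: le2 | apply: descending_le k2i _ Fg].
by move=> /(Zk i k2i)/mk_submodP[].
Qed.

(* Zorn's lemma is applied to the membership predicates, since submodClosed M
   lives in too large a universe. *)
Lemma Zorn_submod (M : lmodType R) (P : submodClosed M -> Prop) N0 : P N0 ->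
  (forall A : submodClosed M -> Prop, (exists N, A N) -> (forall N, A N -> P N) ->
     (forall N N', A N -> A N' -> sub_le N N' \/ sub_le N' N) ->
     exists2 U, P U & forall N, A N -> sub_le N U) ->
  exists2 N, P N & forall N', P N' -> sub_le N N' -> sub_le N' N.
Proof.
move=> PN0 ub.
pose T := {X : M -> bool | exists2 N : submodClosed M, P N & forall u, X u = (u \in N)}.
pose mkT N (PN : P N) : T := exist _ (fun u => u \in N) (ex_intro2 _ _ N PN (fun=> erefl)).
have [|||[X [N PN XN]] maxN] := @classical_sets.ZL_preorder T (mkT N0 PN0)
    (fun X Y => `[< forall u, proj1_sig X u -> proj1_sig Y u >]).
- by move=> X; apply/asboolP.
- by move=> X Y Z /asboolP YX /asboolP XZ; apply/asboolP => u /YX/XZ.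
- move=> A totA.
  case: (pselect (exists X, A X)) => [[X AX]|nA]; last first.
    by exists (mkT N0 PN0) => X AX; case: nA; exists X.
  pose A' (N : submodClosed M) := exists2 Y : T, A Y & forall u, proj1_sig Y u = (u \in N).
  have memP (Y : T) : exists2 N : submodClosed M, P N & forall u, proj1_sig Y u = (u \in N).
    exact: proj2_sig Y.
  have [||L L'|U PU AU] := ub (fun N => P N /\ A' N).
  + by have [N PN XN] := memP X; exists N; split=> //; exists X.
  + by move=> N [].
  + move=> [_ [Y AY YL]] [_ [Y' AY' YL']].
    have [/asboolP YY|/asboolP YY] := totA _ _ AY AY'; [left | right] => u.
      by rewrite -YL -YL'; apply: YY.
    by rewrite -YL -YL'; apply: YY.
  exists (mkT U PU) => Y AY; apply/asboolP => u /=.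
  have [N PN YN] := memP Y; rewrite YN; apply: AU; split=> //; by exists Y.
exists N => // N' PN' NN'.
have /asboolP NX : `[< forall u, u \in N' -> X u >].
  by apply: (maxN (mkT N' PN')); apply/asboolP => u /=; rewrite XN; apply: NN'.
by move=> u /NX; rewrite XN.
Qed.

Section FiniteLength.
Variables (m : submodClosed R^o) (s : seq R^o) (M : lmodType R).
Hypothesis max_m : maximal_ideal m.
Hypothesis gen_m : span (fun a => a \in s) =i m.
Variables (B : submodClosed M).
Implicit Types (Z Y : submodClosed M).

(** [(P + Q) / P] is a quotient of [Q / B]. *)
Lemma len_le_sum P Q a b : sub_le B P -> sub_le B Q ->
  len_le B P a -> len_le B Q b -> len_le B (add_submod P Q) (a + b).
Proof.
move=> BP BQ la lb; apply: len_le_add (sub_addl _) la _; first exact: BP.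
apply: (@len_le_rel _ _ _ (fun u q => q \in Q /\ u - q \in P) _ _ _ _ _ _ _ _ _ BQ lb).
- split=> [|r u u' q q' [Qq Pu] [Qq' Pu']]; first by rewrite subr0 !rpred0.
  rewrite opprD addrACA -scalerBr.
  by split; apply: rpredD => //; apply: rpredZ.
- by move=> u /mk_submodP[y Py [q Qq ->]]; exists q; rewrite addrK.
- by move=> u q _ [].
by move=> u q _ [_ Pu] /BP Pq; rewrite -(subrK q u) rpredD.
Qed.

Fact scale_submod_closed0 (a : R) Z : exists2 z, z \in Z & 0 = a *: z.
Proof. by exists 0; rewrite ?rpred0 ?scaler0. Qed.

Fact scale_submod_closedD (a : R) Z r u v : (exists2 z, z \in Z & u = a *: z) ->
  (exists2 z, z \in Z & v = a *: z) -> exists2 z, z \in Z & r *: u + v = a *: z.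
Proof.
move=> [z Zz ->] [z' Zz' ->]; exists (r *: z + z'); first by rewrite rpredD ?rpredZ.
by rewrite scalerDr !scalerA mulrC.
Qed.

Definition scale_submod a Z := mk_submod (scale_submod_closed0 a Z) (@scale_submod_closedD a Z).

Lemma mem_scale_submod a Z z : z \in Z -> a *: z \in scale_submod a Z.
Proof.
by move=> Zz; apply/(mk_submodP (scale_submod_closed0 a Z) (@scale_submod_closedD a Z)); exists z.
Qed.

Lemma scale_submod_le a Z : sub_le (scale_submod a Z) Z.
Proof. by move=> u /mk_submodP[z Zz ->]; apply: rpredZ. Qed.

(** Iterating [Z <= a Z + B] gives [Z <= a^k Z + B], which lies in [B]. *)
Lemma nilpotent_Nakayama a k Z : (forall z, z \in Z -> a ^+ k *: z \in B) ->
  sub_le Z (add_submod (scale_submod a Z) B) -> sub_le Z B.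
Proof.
move=> akZ Za; have: forall j z, z \in Z -> exists2 u, u \in Z & z - a ^+ j *: u \in B.
  elim=> [|j IHj] z Zz; first by exists z; rewrite // expr0 scale1r subrr rpred0.
  have [u Zu Bu] := IHj z Zz; have /mk_submodP[_ /mk_submodP[v Zv ->] [b Bb uE]] := Za u Zu.
  exists v => //; have -> : z - a ^+ j.+1 *: v = (z - a ^+ j *: u) + a ^+ j *: b.
    by rewrite uE scalerDr scalerA -exprSr opprD addrA subrK.
  by rewrite rpredD ?rpredZ.
move=> /(_ k) Zk z /Zk[u /akZ Bu Bzu]; rewrite -(subrK (a ^+ k *: u) z).
exact: rpredD.
Qed.

(** Take [Z] minimal among the submodules between [B] and [Z0] of infinite length over [B]. Then
    [m Z + B] has finite length over [B], and a hyperplane of [Z] above it is proper, hence of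
    finite length too: adding one gives a finite length for [Z]. *)
Lemma finite_length (Z0 : submodClosed M) : artinian M -> sub_le B Z0 ->
  (forall a, a \in m -> exists k, forall z, z \in Z0 -> a ^+ k *: z \in B) ->
  exists L, len_le B Z0 L.
Proof.
move=> artM BZ0 nilZ0; apply: contrapT => infZ0.
have [Z [BZ ZZ0 infZ] minZ] := @artinian_minimal _
  (fun Z => [/\ sub_le B Z, sub_le Z Z0 & ~ exists L, len_le B Z L]) Z0 artM
  (And3 BZ0 (fun _ h => h) infZ0).
have fin Y : sub_le B Y -> sub_le Y Z -> ~ sub_le Z Y -> exists L, len_le B Y L.
  move=> BY YZ nZY; apply: contrapT => infY; apply/nZY/minZ => //.
  by split=> // u /YZ/ZZ0.
(* [Y0] is the sum of the [a Z + B] over the generators [a] of [m]. Each of these is proper in [Z]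
   by [nilpotent_Nakayama], hence of finite length by minimality. *)
have [Y0 [BY0 Y0Z] [[L0 fin0] mZ]] : exists2 Y0, sub_le B Y0 /\ sub_le Y0 Z &
    (exists L, len_le B Y0 L) /\ forall a z, a \in m -> z \in Z -> a *: z \in Y0.
  suff [Y0 Y0P [finY0 sZ]] : exists2 Y0, sub_le B Y0 /\ sub_le Y0 Z &
      (exists L, len_le B Y0 L) /\ forall a z, a \in s -> z \in Z -> a *: z \in Y0.
    exists Y0 => //; split=> // a z; rewrite -gen_m => /mk_submodP ma Zz.
    have c0 : (0 : R^o) *: z \in Y0 by rewrite scale0r rpred0.
    have cD (r b c : R^o) : b *: z \in Y0 -> c *: z \in Y0 -> (r *: b + c) *: z \in Y0.
      move=> Yb Yc; have -> : (r *: b + c) *: z = r *: (b *: z) + c *: z.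
        by rewrite scalerDl scalerA.
      by apply: rpredD => //; apply: rpredZ.
    suff /mk_submodP : a \in mk_submod (P := fun b : R^o => b *: z \in Y0) c0 cD by [].
    by apply: ma => b bs; apply/mk_submodP/sZ.
  have: forall a, a \in s -> a \in m.
    by move=> a sa; rewrite -gen_m; apply/mk_submodP => N; apply.
  elim: (s) => [|a s' IHs] sm; first by exists B; split=> //; exists 0%N; apply: len_le0.
  have [|Y1 [BY1 Y1Z] [[L1 fin1] sZ]] := IHs.
    by move=> b sb; apply: sm; rewrite inE sb orbT.
  pose Ya := add_submod (scale_submod a Z) B.
  have BYa : sub_le B Ya by apply: sub_addr.
  have YaZ : sub_le Ya Z by apply: add_submod_le => //; apply: scale_submod_le.
  have [nZYa|La fina] := fin Ya BYa YaZ.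
    have [k ak] := nilZ0 a (sm _ (mem_head _ _)).
    apply: infZ; exists 0%N; apply: len_le0; apply: nilpotent_Nakayama nZYa => z /ZZ0.
    exact: ak.
  exists (add_submod Ya Y1); first split.
  - by move=> u /BY1; apply: sub_addr.
  - exact: add_submod_le.
  split; first by exists (La + L1)%N; apply: len_le_sum.
  move=> b z; rewrite inE => /predU1P[->|sb] Zz; last by apply/sub_addr/sZ.
  by apply: sub_addl; apply: sub_addl; apply: mem_scale_submod.
have [z Zz nY0z] : exists2 z, z \in Z & z \notin Y0.
  apply: contrapT => nex; apply: infZ; exists L0; apply: len_le_mono fin0 => z Zz.
  by apply/negPn/negP => nY0z; apply: nex; exists z.
(* [Z / Y0] is a vector space over the residue field, and a maximal subspace avoiding [z] is a
   hyperplane. *)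
have [|Y [Y0Y YZ nYz] maxY] := @Zorn_submod _
  (fun Y => [/\ sub_le Y0 Y, sub_le Y Z & z \notin Y]) Y0
  (And3 (fun _ h => h) Y0Z nY0z).
- move=> A [N1 AN1] AP totA.
  have N10 := AN1; have U0 : exists2 N, A N & 0 \in N by exists N1; rewrite ?rpred0.
  have UD a u v : (exists2 N, A N & u \in N) -> (exists2 N, A N & v \in N) ->
      exists2 N, A N & a *: u + v \in N.
    move=> [N AN Nu] [N' AN' N'v].
    have [NN'|N'N] := totA _ _ AN AN'; [exists N' | exists N] => //.
      by rewrite rpredD ?rpredZ ?(NN' u Nu).
    by rewrite rpredD ?rpredZ ?(N'N v N'v).
  exists (mk_submod U0 UD); last by move=> N AN u Nu; apply/mk_submodP; exists N.
  have [Y0N1 _ _] := AP _ AN1; split=> [u /Y0N1 Nu|u /mk_submodP[N /AP[_ NZ _] /NZ]//|].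
    by apply/mk_submodP; exists N1.
  by apply/negP => /mk_submodP[N /AP[_ _ /negP]].
have [Ly finY] : exists L, len_le B Y L.
  by apply: (fin Y _ YZ) => [u /BY0/Y0Y//|ZY]; move: nYz; rewrite ZY.
apply: infZ; exists (Ly + 1)%N; apply: (len_le_add _ YZ finY) => [u /BY0/Y0Y//|].
(* A longer chain would have a term [Q] strictly between [Y] and [Z]. By maximality of [Y], both [Q]
   and [Y + R w], for [w] outside [Y], contain [z]; solving for [w] puts it in [Q]. *)
move=> [|[|k]]//= [Q [Q' /chain_le YQ' [Q'Q nQQ']] [QZ nZQ]]; case: nZQ => w Zw.
have YQ : sub_le Y Q by move=> u /YQ'/Q'Q.
have Qz : z \in Q.
  apply/negPn/negP => nQz; apply: nQQ' => u Qu; apply: YQ'; apply: (maxY Q) Qu => //.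
  by split=> // v /Y0Y/YQ.
case: (boolP (w \in Y)) => [/YQ//|nYw].
pose Y' := add_submod Y (cyclic w).
have Y'z : z \in Y'.
  apply/negPn/negP => nY'z; move/negP: nYw; apply; apply: (maxY Y').
  - split=> //; first by move=> u /Y0Y; exact: (@sub_addl _ _ Y).
    by apply: add_submod_le; [exact: YZ | move=> u /mk_submodP[r ->]; apply: rpredZ].
  - exact: sub_addl.
  - exact/sub_addr/mem_cyclic.
have /mk_submodP[y Yy [_ /mk_submodP[r ->] zE]] := Y'z.
case: (boolP ((r : R^o) \in m)) => [mr|nmr].
  by move: nYz; rewrite zE rpredD// Y0Y// mZ.
(* Here [r] is invertible modulo [m]: maximality gives [1 = a + b * r] with [a] in [m]. *)
pose J := add_submod m (cyclic (r : R^o)).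
have J1 : (1 : R^o) \in J.
  apply/negPn/negP => nJ1; move/negP: nmr; apply.
  by rewrite -(max_m.2 J _ nJ1); [apply/sub_addr/mem_cyclic | apply: sub_addl].
have /mk_submodP[a ma [_ /mk_submodP[b ->] ab1]] := J1.
have -> : w = a *: w + b *: (z - y).
  by rewrite zE addrAC subrr add0r scalerA -scalerDl -[X in X *: _]ab1 scale1r.
apply: rpredD; first by apply: YQ; apply: Y0Y; apply: mZ.
by apply: rpredZ; apply: submodB => //; apply: YQ.
Qed.
End FiniteLength.
End Artinian.

(** * Torsion of injective modules *)

Lemma span_ind (R : comNzRingType) (M : lmodType R) (X Q : M -> Prop) : Q 0 ->
  (forall a u v, Q u -> Q v -> Q (a *: u + v)) ->
  (forall y, X y -> Q y) -> forall y, y \in span X -> Q y.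
Proof.
move=> Q0 QD XQ y /mk_submodP yX.
suff /(mk_submodP Q0 QD) : y \in mk_submod Q0 QD by [].
by apply: yX => z /XQ Qz; apply/(mk_submodP Q0 QD).
Qed.

Lemma mem_span (R : comNzRingType) (M : lmodType R) (X : M -> Prop) y : X y -> y \in span X.
Proof. by move=> Xy; apply/mk_submodP => N; apply. Qed.

Section IdealPowers.
Variables (R : comNzRingType) (m : submodClosed R^o).

Lemma mem_ideal_pow (a : R) k : (a : R^o) \in m -> (a ^+ k : R^o) \in ideal_pow m k.
Proof.
move=> ma; elim: k => [|k IHk]; first exact: mem_full_submod.
by rewrite exprS; apply: mem_span; exists a => //; exists (a ^+ k : R^o).
Qed.

Lemma ideal_powS_kill (E : lmodType R) (s : seq R^o) N (e : E) :
  span (fun a => a \in s) =i m ->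
  (forall a z : R, (a : R^o) \in s -> (z : R^o) \in ideal_pow m N -> z *: (a *: e) = 0) ->
  forall y : R, (y : R^o) \in ideal_pow m N.+1 -> y *: e = 0.
Proof.
move=> gen_m kill_s.
apply: (span_ind (Q := fun y : R^o => (y : R) *: e = 0)) => [|r b c rb rc|_ [a ma [z zN ->]]].
- by rewrite scale0r.
- by rewrite scalerDl -scalerA rb rc scaler0 addr0.
rewrite -scalerA; move: ma; rewrite -gen_m; move: a.
apply: (span_ind (Q := fun a : R^o => (a : R) *: (z *: e) = 0)) => [|r b c rb rc|a sa].
- by rewrite scale0r.
- by rewrite scalerDl -scalerA rb rc scaler0 addr0.
by rewrite scalerA mulrC -scalerA kill_s.
Qed.

(** Pigeonhole: a product of [N.+1] generators contains some [a] at least [k a] times. In the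
    induction, passing from [e] to [a *: e] lowers the exponent of [a] by one. *)
Lemma ideal_pow_kill (E : lmodType R) (s : seq R^o) N (k : R -> nat) (e : E) :
  span (fun a => a \in s) =i m -> uniq s -> (\sum_(a <- s) k a <= N)%N ->
  (forall a, a \in s -> (a : R) ^+ k a *: e = 0) ->
  forall y : R, (y : R^o) \in ideal_pow m N.+1 -> y *: e = 0.
Proof.
move=> gen_m us; elim: N k e => [|N IHN] k e kN ke; apply: (ideal_powS_kill gen_m) => a z sa.
  have /eqP ka0 : k a == 0%N.
    by rewrite -leqn0; apply: leq_trans kN; rewrite (bigD1_seq a)//= leq_addr.
  by have := ke a sa; rewrite ka0 expr0 scale1r => ->; rewrite !scaler0.
case: (posnP (k a)) => [ka0|ka].
  by have := ke a sa; rewrite ka0 expr0 scale1r => ->; rewrite !scaler0.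
apply: (IHN (fun b => if b == a then (k a).-1 else k b)).
  rewrite (bigD1_seq a)//= eqxx -ltnS; apply: leq_trans kN.
  rewrite [X in (_ <= X)%N](bigD1_seq a)//= -addSn leq_add ?prednK//.
  by apply: eq_leq; apply: eq_bigr => b /negPf->.
move=> b sb; case: eqP => [->|_].
  by rewrite scalerA -exprSr prednK// ke.
by rewrite scalerA mulrC -scalerA ke// scaler0.
Qed.

End IdealPowers.

Section ParameterTorsion.
Variables (R : comNzRingType) (m : submodClosed R^o) (n : nat) (x : 'I_n -> R).
Hypothesis noethR : noetherian R.
Hypothesis max_m : maximal_ideal m.
Hypothesis x_m : forall i, (x i : R^o) \in m.
Hypothesis rad_x : forall a : R, (a : R^o) \in m ->
  exists k, (a ^+ k : R^o) \in span (fun y : R^o => exists i, y = x i).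

(** The homotopy [khom i] shows that [x i] kills the homology, so every element of [m] has a power
    that does; chains with entries in [V] form an Artinian module, and [finite_length] applies. *)
Lemma klen_artinian (V : lmodType R) p : artinian V ->
  exists L, klen x (full_submod V) (zero_submod V) p L.
Proof.
move=> artV; have [s gen_m] := noethR m.
apply: (finite_length max_m gen_m); first exact: artinian_ffun.
  exact/koszul_bounds_cycles/zero_submod_le.
move=> a /rad_x[k ak]; exists k => z zc; move: (a ^+ k) ak.
apply: span_ind => [|r b c rb rc|_ [i ->]].
- by rewrite scale0r rpred0.
- by rewrite scalerDl -scalerA; apply: rpredD => //; apply: rpredZ.
apply/koszul_boundsP; exists (khom i z) => S; first exact: mem_full_submod.
have /koszul_cyclesP[_ dz] := zc.
rewrite -(khomE x i z) addrAC subrr add0r; apply: khom_mem dz _.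
Qed.

(** Division by [y] up to [y]-power torsion. The annihilators of the [y^k e] stabilise, so [y] is
    injective on [R y^k e] for some [k]; a map [g] with [g (y u) = u] on this submodule extends to
    [E], and [e' = g e]. The clause on annihilators keeps [e'] as torsion as [e]. *)
Lemma injective_divides (E : lmodType R) (y : R) (e : E) : injective_module E ->
  exists e' k, y ^+ k.+1 *: e' = y ^+ k *: e /\ forall a : R, a *: e = 0 -> a *: e' = 0.
Proof.
move=> injE.
have I0 k : (0 : R) *: (y ^+ k *: e) = 0 by rewrite scale0r.
have ID k (a b c : R^o) : (b : R) *: (y ^+ k *: e) = 0 -> (c : R) *: (y ^+ k *: e) = 0 ->
    (a *: b + c : R) *: (y ^+ k *: e) = 0.
  by move=> b0 c0; rewrite scalerDl -scalerA b0 c0 scaler0 addr0.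
pose I k : submodClosed R^o :=
  mk_submod (P := fun b : R^o => (b : R) *: (y ^+ k *: e) = 0) (I0 k) (ID k).
have memI k (b : R^o) : reflect ((b : R) *: (y ^+ k *: e) = 0) (b \in I k).
  exact: (mk_submodP (I0 k) (ID k)).
have [k|k Ik] := noetherian_acc noethR (F := I).
  move=> b /memI b0; apply/memI.
  by rewrite exprS -scalerA scalerA mulrC -scalerA b0 scaler0.
pose A := cyclic (y ^+ k *: e).
pose f : {linear sub_type A -> E} := \val.
pose i : {linear sub_type A -> E} := y \*: f.
have inj_i : injective i.
  apply: raddf_inj => u /= yu0; apply: val_inj; rewrite raddf0.
  have /mk_submodP[r ru] := valP u.
  have : (r : R^o) \in I k.+1.
    by apply/memI; rewrite exprS -scalerA scalerA mulrC -scalerA -ru.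
  by move/(Ik k.+1)/memI; rewrite -ru.
have [g gi] := injE _ _ i f inj_i.
exists (g e), k; split; last by move=> a a0; rewrite -linearZ a0 linear0.
have Ae := mem_cyclic (y ^+ k *: e).
have gu := gi (exist (fun v => v \in A) _ Ae : sub_type A).
by rewrite -linearZ exprS -scalerA; apply: gu.
Qed.

Section Torsion.
Variable E : lmodType R.

Let in_partial i (e : E) := forall s : 'I_n, (s < i)%N -> exists k, x s ^+ k *: e = 0.

Fact partial_torsion_closed0 i : in_partial i 0.
Proof. by move=> s _; exists 0%N; rewrite scaler0. Qed.

Fact partial_torsion_closedD i a u v : in_partial i u -> in_partial i v ->
  in_partial i (a *: u + v).
Proof.
move=> uP vP s si; have [[k uk] [l vl]] := (uP s si, vP s si); exists (k + l)%N.
rewrite scalerDr scalerA mulrC -scalerA exprD [X in a *: (X *: _)]mulrC -!scalerA.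
by rewrite uk vl !scaler0 addr0.
Qed.

Definition partial_torsion i : submodClosed E :=
  mk_submod (@partial_torsion_closed0 i) (@partial_torsion_closedD i).

Lemma partial_torsionP i e : reflect (in_partial i e) (e \in partial_torsion i).
Proof. exact: mk_submodP. Qed.

Lemma partial_torsionS i : sub_le (partial_torsion i.+1) (partial_torsion i).
Proof.
by move=> e /partial_torsionP eP; apply/partial_torsionP => s si; apply/eP/ltnW.
Qed.

(** On each successive quotient the next parameter acts bijectively: injectively by raising an
    exponent by one, surjectively by [injective_divides]. For [i = 0] the quotient is zero. *)
Lemma koszul_acyclic_partial i : injective_module E -> (i <= n)%N ->
  koszul_acyclic x (full_submod E) (partial_torsion i).
Proof.
move=> injE; elim: i => [_|i IHi lt_in].
  move=> p f _; apply/koszul_boundsP; exists 0 => S; first by rewrite koszul0E rpred0.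
  by apply/partial_torsionP.
have le_full N : sub_le N (full_submod E) by move=> u _; apply: mem_full_submod.
apply: koszul_acyclic_trans (IHi (ltnW lt_in)) _ => //; first exact: partial_torsionS.
apply: (@koszul_acyclic_bij _ _ _ _ _ _ (Ordinal lt_in)); first exact: partial_torsionS.
  move=> a /partial_torsionP aP /partial_torsionP xaP; apply/partial_torsionP => s.
  rewrite ltnS leq_eqVlt => /predU1P[si|]; last exact: aP.
  have sE : s = Ordinal lt_in by apply: val_inj.
  have [|k xk] := xaP s; first by rewrite si.
  by exists k.+1; rewrite exprSr -scalerA {2}sE.
move=> a /partial_torsionP aP.
have [e [k [ek ann_e]]] := injective_divides (x (Ordinal lt_in)) a injE.
have eP : in_partial i e by move=> s /aP[l al]; exists l; apply: ann_e.
exists e; first exact/partial_torsionP.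
apply/partial_torsionP => s; rewrite ltnS leq_eqVlt => /predU1P[si|si].
  have -> : s = Ordinal lt_in by apply: val_inj.
  by exists k; rewrite scalerBr scalerA -exprSr ek subrr.
have [l al] := aP s si; exists l.
by rewrite scalerBr al scalerA mulrC -scalerA ann_e// scaler0 subrr.
Qed.

(** Two uses of [ideal_pow_kill]: torsion for each [x i] gives a power [J^N] of the parameter ideal
    killing [e]; if [a^k] is in [J], then [a^(k * N)] kills [e], which applies to the generators of
    [m]. *)
Lemma torsion_partial : torsion m E =i partial_torsion n.
Proof.
move=> e; apply/torsionP/partial_torsionP => [[k ke] s _|eP].
  by exists k; apply: ke; apply: mem_ideal_pow.
pose J := span (fun y : R^o => exists i, y = x i).
have undup_span (s : seq R^o) (X : R^o -> Prop) : (forall y, X y <-> y \in s) ->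
    span (fun y => y \in undup s) =i span X.
  move=> sX a; apply/idP/idP => /mk_submodP aP; apply: aP => b.
    by rewrite mem_undup => /sX; apply: mem_span.
  by move=> Xb; apply: mem_span; rewrite mem_undup; apply/sX.
have [N JN] : exists N, forall y : R, (y : R^o) \in ideal_pow J N -> y *: e = 0.
  pose s := [seq (x i : R^o) | i <- enum 'I_n].
  have gen_s : span (fun y => y \in undup s) =i J.
    apply: undup_span => y; split=> [[i ->]|/mapP[i _ ->]]; last by exists i.
    by apply: map_f; rewrite mem_enum.
  have /choice[k kP] : forall a : R, exists k, (a : R^o) \in s -> a ^+ k *: e = 0.
    move=> a; case: (boolP ((a : R^o) \in s)) => [/mapP[i _ ->]|]; last by exists 0%N.
    by have [k xk] := eP i (ltn_ord i); exists k.
  exists (\sum_(a <- undup s) k a).+1.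
  apply: (ideal_pow_kill gen_s (undup_uniq s) (leqnn _)) => a; rewrite mem_undup; exact: kP.
have [s gen_s] := noethR m.
have gen_us : span (fun y => y \in undup s) =i m.
  by move=> a; rewrite (undup_span s (fun y => y \in s)) ?gen_s.
have /choice[k kP] : forall a : R, exists k, (a : R^o) \in undup s -> a ^+ k *: e = 0.
  move=> a; case: (boolP ((a : R^o) \in undup s)) => [sa|]; last by exists 0%N.
  have [k ak] : exists k, (a ^+ k : R^o) \in J.
    by apply: rad_x; rewrite -gen_us; apply: mem_span.
  by exists (k * N)%N => _; rewrite exprM; apply/JN/mem_ideal_pow.
exists (\sum_(a <- undup s) k a).+1.
exact: (ideal_pow_kill gen_us (undup_uniq s) (leqnn _)).
Qed.

Lemma koszul_acyclic_torsion : injective_module E ->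
  koszul_acyclic x (full_submod E) (torsion m E).
Proof.
move=> injE p f /koszul_cyclesP[Ef df].
have /(koszul_acyclic_partial injE (leqnn n))/koszul_boundsP[g Eg fg] :
    f \in koszul_cycles x (full_submod E) (partial_torsion n) p.
  by apply/koszul_cyclesP; split=> // S; rewrite -torsion_partial.
by apply/koszul_boundsP; exists g => // S; rewrite torsion_partial.
Qed.

End Torsion.
End ParameterTorsion.

(** * Existence of a system of parameters *)

Section Primes.
Variable R : comNzRingType.
Hypothesis noethR : noetherian R.
Implicit Types (I J P Q m : submodClosed R^o).

Lemma not_sub_le I J : ~ sub_le I J -> exists2 a : R, (a : R^o) \in I & (a : R^o) \notin J.
Proof.
move=> nIJ; apply: contrapT => nex; apply: nIJ => a Ia.
by apply/negPn/negP => nJa; apply: nex; exists a.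
Qed.

Lemma mem_idealM I (a b : R) : (b : R^o) \in I -> (a * b : R^o) \in I.
Proof. by move=> Ib; rewrite -[(a * b : R^o)]/(a *: (b : R^o)); apply: rpredZ. Qed.

Lemma mem_idealMr I (a b : R) : (a : R^o) \in I -> (a * b : R^o) \in I.
Proof. by rewrite mulrC; apply: mem_idealM. Qed.

Definition adjoin I (a : R) := add_submod I (cyclic (a : R^o)).

Lemma adjoinP I (a b : R) : (b : R^o) \in adjoin I a ->
  exists2 c : R, (c : R^o) \in I & exists r : R, b = c + r * a.
Proof. by move=> /mk_submodP[c Ic [_ /mk_submodP[r ->] ->]]; exists c => //; exists r. Qed.

Lemma mem_adjoin I (a : R) : (a : R^o) \in adjoin I a.
Proof. exact/sub_addr/mem_cyclic. Qed.

Lemma sub_adjoin I a : sub_le I (adjoin I a).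
Proof. exact: sub_addl. Qed.

Lemma adjoin_mul I (a b c e : R) : (a * b : R^o) \in I ->
  (c : R^o) \in adjoin I a -> (e : R^o) \in adjoin I b -> (c * e : R^o) \in I.
Proof.
move=> Iab /adjoinP[u Iu [r ->]] /adjoinP[v Iv [s ->]].
have -> : (u + r * a) * (v + s * b) = u * (v + s * b) + (r * a * v + r * s * (a * b)) by ring.
apply: (@rpredD _ I); first exact: mem_idealMr.
by apply: (@rpredD _ I); apply: mem_idealM.
Qed.

Lemma maximal_prime m : maximal_ideal m -> prime_ideal m.
Proof.
move=> [n1 maxm]; split=> // a b mab.
case: (boolP ((a : R^o) \in m)) => //= nma; apply/negPn/negP => nmb.
have in1 c : (c : R^o) \notin m -> (1 : R^o) \in adjoin m c.
  move=> nmc; apply/negPn/negP => n1c; move/negP: nmc; apply.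
  by rewrite -(maxm _ (@sub_adjoin m c) n1c); apply: mem_adjoin.
by move/negP: n1; apply; rewrite -[1]mulr1; apply: adjoin_mul mab (in1 a nma) (in1 b nmb).
Qed.

Lemma sub_le_local m I : local_ring m -> (1 : R^o) \notin I -> sub_le I m.
Proof.
move=> [_ um] nI1.
have [J [IJ nJ1] maxJ] := noetherian_maximal noethR
  (P := fun J => sub_le I J /\ (1 : R^o) \notin J) (conj (fun _ h => h) nI1).
have Jm : J =i m.
  apply: um; split=> // K JK nK1 a; apply/idP/idP; last exact: JK.
  by apply: maxJ => //; split=> // b /IJ/JK.
by move=> a /IJ; rewrite Jm.
Qed.

(** An ideal maximal among those that contain [I] and no power of [a] is prime. *)
Lemma prime_avoiding_powers I (a : R) : (forall k, (a ^+ k : R^o) \notin I) ->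
  exists2 P, prime_ideal P & sub_le I P /\ (a : R^o) \notin P.
Proof.
move=> naI; have [P [IP naP] maxP] := noetherian_maximal noethR
  (P := fun J => sub_le I J /\ forall k, (a ^+ k : R^o) \notin J) (conj (fun _ h => h) naI).
exists P; last by split=> //; have := naP 1%N; rewrite expr1.
split; first by have := naP 0%N; rewrite expr0.
move=> b c Pbc; case: (boolP ((b : R^o) \in P)) => //= nPb; apply/negPn/negP => nPc.
have pow u : (u : R^o) \notin P -> exists k, (a ^+ k : R^o) \in adjoin P u.
  move=> nPu; apply: contrapT => nex; move/negP: nPu; apply.
  apply: (maxP (adjoin P u)); [split | exact: sub_adjoin | exact: mem_adjoin].
    by move=> v /IP; apply: sub_adjoin.
  by move=> k; apply/negP => ak; apply: nex; exists k.
have [[k ak] [l al]] := (pow b nPb, pow c nPc).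
have /negP[] := naP (k + l)%N; rewrite exprD.
exact: adjoin_mul Pbc ak al.
Qed.

(** Supplies finitely many primes including all minimal ones over [I]. A maximal counterexample is
    proper and not prime, so it contains some [a * b] but neither factor; primes above it lie above
    one of the two adjunctions, which are good. *)
Lemma finite_primes_over I : exists Qs : seq (submodClosed R^o),
  (forall Q, List.In Q Qs -> prime_ideal Q) /\
  forall P, prime_ideal P -> sub_le I P -> exists2 Q, List.In Q Qs & sub_le I Q /\ sub_le Q P.
Proof.
pose good J := exists Qs : seq (submodClosed R^o),
  (forall Q, List.In Q Qs -> prime_ideal Q) /\
  forall P, prime_ideal P -> sub_le J P -> exists2 Q, List.In Q Qs & sub_le J Q /\ sub_le Q P.
rewrite -/(good I); apply: contrapT => badI.
have {I badI} [I badI maxI] := noetherian_maximal noethR (P := fun J => ~ good J) badI.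
have good_adjoin a : (a : R^o) \notin I -> good (adjoin I a).
  move=> nIa; apply: contrapT => bad; move/negP: nIa; apply.
  by apply: (maxI (adjoin I a)) => //; [exact: sub_adjoin | exact: mem_adjoin].
apply: badI; case: (pselect (prime_ideal I)) => [pI|nprime].
  by exists [:: I]; split=> [Q /= [<-|]//|P _ IP]; exists I; [left | split].
case: (boolP ((1 : R^o) \in I)) => [I1|nI1].
  by exists [::]; split=> // P [/negP nP1 _] /(_ 1 I1).
have [a [b [Iab nIa nIb]]] : exists a b : R,
    [/\ (a * b : R^o) \in I, (a : R^o) \notin I & (b : R^o) \notin I].
  apply: contrapT => nex; apply: nprime; split=> // a b Iab.
  case: (boolP ((a : R^o) \in I)) => //= nIa; apply/negPn/negP => nIb.
  by apply: nex; exists a, b.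
have [[Qs [pQs Qsa]] [Qs' [pQs' Qsb]]] := (good_adjoin a nIa, good_adjoin b nIb).
exists (Qs ++ Qs'); split=> [Q /List.in_app_iff[/pQs|/pQs']//|P pP IP].
have adj c : (c : R^o) \in P -> sub_le (adjoin I c) P.
  by move=> Pc; apply: add_submod_le => // _ /mk_submodP[r ->]; apply: rpredZ.
have /orP[Pa|Pb] := pP.2 a b (IP _ Iab).
  have [Q QQs [aQ QP]] := Qsa P pP (adj a Pa).
  exists Q; first by apply/List.in_app_iff; left.
  by split=> // u Iu; apply/aQ/sub_adjoin.
have [Q QQs [bQ QP]] := Qsb P pP (adj b Pb).
exists Q; first by apply/List.in_app_iff; right.
by split=> // u Iu; apply/bQ/sub_adjoin.
Qed.

(** Induction on the number of primes. A prime containing [J] imposes nothing, and a prime contained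
    in another is avoided with it. Otherwise an element avoiding the tail is corrected by [b] if it
    lies in [P]. *)
Lemma prime_avoidance J (Qs : seq (submodClosed R^o)) :
  (forall Q, List.In Q Qs -> prime_ideal Q) ->
  exists2 a : R, (a : R^o) \in J & forall Q, List.In Q Qs -> ~ sub_le J Q -> (a : R^o) \notin Q.
Proof.
have [n] := ubnP (size Qs); elim: n Qs => // n IHn [|P Qs] /= szQs pQs.
  by exists 0 => //; apply: rpred0.
have pP : prime_ideal P by apply: pQs; left.
case: (pselect (sub_le J P)) => [JP|nJP].
  have [||a Ja aQs] := IHn Qs => //; first by move=> Q QQs; apply: pQs; right.
  by exists a => // Q [<- //|]; apply: aQs.
case: (pselect (exists2 Q, List.In Q Qs & sub_le Q P)) => [[Q QQs QP]|nQP].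
  have [s1 [s2 QsE]] := List.in_split Q Qs QQs.
  have [||a Ja aQs] := IHn (P :: (s1 ++ s2)).
  - by move: szQs; rewrite QsE /= !size_cat /= addnS.
  - move=> Q' Q'in; apply: pQs; rewrite QsE; case: Q'in => [|Q'in]; first by left.
    by right; apply/List.in_app_iff; move/List.in_app_iff: Q'in => [|]; [left | right; right].
  exists a => // Q' Q'in nJQ'.
  have aP : (a : R^o) \notin P by apply: aQs => //; left.
  move: Q'in; rewrite QsE => -[<-//|/List.in_app_iff[Q's|[<-|Q's]]].
  + by apply: aQs => //; right; apply/List.in_app_iff; left.
  + by apply: contra aP; apply: QP.
  by apply: aQs => //; right; apply/List.in_app_iff; right.
have [||a Ja aQs] := IHn Qs => //; first by move=> Q QQs; apply: pQs; right.
case: (boolP ((a : R^o) \in P)) => [Pa|nPa]; last first.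
  by exists a => // Q [<-//|]; apply: aQs.
(* [b] is the product of an element of [J] and one of each [Q], all outside the prime [P]. *)
have [b [Jb nPb] bQs] : exists2 b : R, (b : R^o) \in J /\ (b : R^o) \notin P &
    forall Q, List.In Q Qs -> (b : R^o) \in Q.
  have {}nQP Q : List.In Q Qs -> ~ sub_le Q P by move=> QQs QP; apply: nQP; exists Q.
  elim: (Qs) nQP => [_|Q s IHs nQP]; first by have [b Jb nPb] := not_sub_le nJP; exists b.
  have [|b [Jb nPb] bs] := IHs; first by move=> Q' Q's; apply: nQP; right.
  have [|c Qc nPc] := @not_sub_le Q P; first by apply: nQP; left.
  exists (c * b) => [|Q' [<-|/bs]]; last 2 first.
  - exact: mem_idealMr.
  - exact: mem_idealM.
  by split; [exact: mem_idealM | apply/negP => /(pP.2) /orP[]; exact/negP].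
exists (a + b); first exact: (@rpredD _ J).
move=> Q [<- _|QQs nJQ].
  apply: contra nPb => Pab; have -> : b = a + b - a by rewrite addrAC subrr add0r.
  exact: (@submodB _ _ P).
apply: contra (aQs Q QQs nJQ) => Qab; have -> : a = a + b - b by rewrite addrK.
by apply: (@submodB _ _ Q) => //; apply: bQs.
Qed.

(** [P] is a prime of height at least [k]. *)
Fixpoint chain_to k P : Prop :=
  prime_ideal P /\ if k is j.+1 then exists2 Q, chain_to j Q & sub_lt Q P else True.

Lemma prime_chain_to k P : chain_to k P -> prime_chain R^o k.
Proof.
move=> Pk; have [F [FP F_ltF _]] : exists F : nat -> submodClosed R^o,
    [/\ forall i, (i <= k)%N -> prime_ideal (F i),
        forall i, (i < k)%N -> sub_lt (F i) (F i.+1) & F k = P].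
  elim: k P Pk => [|k IHk] P /= [pP]; first by exists (fun=> P); split.
  move=> [Q /IHk[F [FP ltF <-]] ltQP].
  exists (fun i => if (i <= k)%N then F i else P); split=> [i|i|] /=.
  - by case: ifP => [/FP|].
  - rewrite ltnS leq_eqVlt => /predU1P[->|ik]; first by rewrite eqxx ltnn.
    by rewrite ik orbT; apply: ltF.
  by rewrite ltnn.
exists F; split=> // i ik a a0; have := a0 (1 : R^o).
by rewrite -[a *: _]/(a * 1) mulr1 => ->; apply: rpred0.
Qed.

(** The next element avoids those [Q] in the finite list over the previous ones that do not contain
    [m]. A prime containing all the elements lies above some [Q]: either it is [m], or it is
    strictly above [Q] and its height grows by one. *)
Lemma exists_parameters m i : local_ring m -> exists xs : seq R^o,
  [/\ size xs = i, forall a, a \in xs -> a \in m & forall P, prime_ideal P ->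
      (forall a, a \in xs -> a \in P) -> P =i m \/ chain_to i P].
Proof.
move=> loc_m; elim: i => [|i [xs [sz_xs xs_m xsP]]].
  by exists [::]; split=> // P pP _; right.
have [Qs [pQs QsP]] := finite_primes_over (span (fun a => a \in xs)).
have [a ma aQs] := prime_avoidance m pQs.
exists ((a : R^o) :: xs); split=> [|b|P pP axsP]; first by rewrite /= sz_xs.
  by rewrite inE => /predU1P[->|/xs_m].
have eqm J : (1 : R^o) \notin J -> sub_le m J -> J =i m by move=> nJ1 mJ; apply: loc_m.1.2.
have [Q QQs [xsQ QP]] : exists2 Q, List.In Q Qs & sub_le (span (fun a => a \in xs)) Q /\ sub_le Q P.
  apply: QsP => // b /mk_submodP; apply=> c xsc; apply: axsP; by rewrite inE xsc orbT.
case: (pselect (sub_le m Q)) => [mQ|nmQ].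
  by left; apply: eqm pP.1 _ => b /mQ/QP.
have naQ := aQs Q QQs nmQ.
right; split=> //; exists Q; last first.
  by split=> // PQ; move/negP: naQ; apply; apply/PQ/axsP/mem_head.
have [|||//] := xsP Q; first exact: pQs.
  by move=> b xsb; apply/xsQ/mem_span.
by move=> Qm; case: nmQ => b; rewrite Qm.
Qed.

(** If no power of [a] in [m] lay in the parameter ideal, a prime above that ideal would miss [a].
    It would have height at least [d] and be strictly below [m], giving a chain of length [d.+1]. *)
Lemma exists_system_of_parameters m d : local_ring m -> has_krull_dim R^o d ->
  exists x : 'I_d -> R, system_of_parameters m x.
Proof.
move=> loc_m dimR; have [xs [sz_xs xs_m xsP]] := exists_parameters d loc_m.
exists (fun i => xs`_i); split=> //.
  by move=> i; apply/xs_m/mem_nth; rewrite sz_xs.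
move=> a ma; apply: contrapT => nex.
have [k|P pP [xP nPa]] :=
    @prime_avoiding_powers (span (fun y : R^o => exists i : 'I_d, y = xs`_i)) a.
  by apply/negP => ak; apply: nex; exists k.
have [||Pm|Pd] := xsP P => //.
- move=> b xsb; apply/xP/mem_span.
  have ib : (index b xs < d)%N by rewrite -sz_xs index_mem.
  by exists (Ordinal ib); rewrite /= nth_index.
- by move/negP: nPa; apply; rewrite Pm.
have : (d.+1 <= d)%N; last by rewrite ltnn.
apply: dimR.2; apply: (@prime_chain_to d.+1 m); split; first exact/maximal_prime/loc_m.1.
exists P => //; split; first exact: sub_le_local loc_m pP.1.
by move=> mP; move/negP: nPa; apply; apply: mP.
Qed.

End Primes.

(** * Koszul homology against local cohomology *)

Section LocalCohomologyBound.
Variables (R : comNzRingType) (n : nat) (x : 'I_n -> R).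

Lemma klen_ext (M : lmodType R) (A B A' B' : submodClosed M) p L :
  A =i A' -> B =i B' -> sub_le B' A' -> klen x A' B' p L -> klen x A B p L.
Proof.
move=> eA eB BA'; apply: (klen_rel (@linear_rel_eq _ M)) BA' _ _ _ _.
- by move=> u _; exists u.
- by move=> u Au; exists u; rewrite ?eA.
- by move=> u v Au <-; rewrite -eA.
by move=> u v Au <-; rewrite eB.
Qed.

Lemma klen_filtration (I : Type) (V : I -> lmodType R) (H : lmodType R) l p c :
  (forall v, klen x (full_submod (V v)) (zero_submod (V v)) p c) ->
  has_filtration V H l -> klen x (full_submod H) (zero_submod H) p (l * c).
Proof.
move=> lV [F [F0 Fl FS]].
apply: (@klen_ext _ _ _ (F l) (zero_submod H)) => // [u|]; rewrite ?Fl//.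
  exact: zero_submod_le.
suff: forall i, (i <= l)%N -> klen x (F i) (zero_submod H) p (i * c) by apply.
elim=> [_|i IHi il].
  apply: (@klen_ext _ _ _ (zero_submod H) (zero_submod H)) => //.
  exact: klen_refl.
have [FiS [v [phi [psi phiK psiK]]]] := FS i il.
rewrite mulSn addnC; apply: klen_add (IHi (ltnW il)) _ => //; first exact: zero_submod_le.
pose rho (h : H) (w : V v) := exists2 q, subquo_rel (A := F i.+1) (B := F i) h q & phi q = w.
have lrho : linear_rel rho.
  have [q0 qD] := @subquo_linear _ _ (F i.+1) (F i).
  split; first by exists 0; rewrite ?linear0.
  move=> a u u' w w' [q uq <-] [q' uq' <-]; exists (a *: q + q'); last exact: linearP.
  exact: qD.
apply: (klen_rel lrho _ _ _ _ _ (lV v)) => [|u Fu|w _|u w _ _|u w Fu [q uq <-]].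
- exact: zero_submod_le.
- by have [q uq] := subquo_rel_total (F i) Fu; exists (phi q); exists q.
- have [u uq] := subquo_rel_onto (psi w).
  by exists u; [apply: subquo_rel_mem uq | exists (psi w)].
- exact: mem_full_submod.
rewrite mem_zero_submod -(subquo_rel_zero uq); split=> [->|/eqP phiq0].
  by rewrite linear0.
by apply: (can_inj phiK); rewrite phiq0 linear0.
Qed.

(** Local cohomology is a subquotient of the module of torsion elements; this moves it to submodules
    of the ambient term of the resolution. *)
Lemma klen_subquotient (M : lmodType R) (N : submodClosed M)
    (K I : submodClosed (sub_type N)) (A B : submodClosed M) p L :
  (forall u, u \in K <-> val u \in A) -> (forall u, u \in I <-> val u \in B) ->
  sub_le A N ->
  klen x (full_submod (subquotient K I)) (zero_submod _) p L -> klen x A B p L.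
Proof.
move=> KA IB AN.
pose rho (e : M) (h : subquotient K I) := exists2 u : sub_type N, val u = e & subquo_rel u h.
have lrho : linear_rel rho.
  have [q0 qD] := @subquo_linear _ _ K I.
  split; first by exists 0; rewrite ?raddf0.
  move=> a u u' w w' [q <- uq] [q' <- uq']; exists (a *: q + q'); first by rewrite linearP.
  exact: qD.
apply: (klen_rel lrho) => [|u Au|h _|u w _ _|e h _ [u <- uh]].
- exact: zero_submod_le.
- have Ku : (exist (fun v => v \in N) u (AN u Au) : sub_type N) \in K by apply/KA.
  by have [h uh] := subquo_rel_total I Ku; exists h; exists (exist (fun v => v \in N) u (AN u Au)).
- have [u uh] := subquo_rel_onto h; exists (val u); last by exists u.
  exact: (proj1 (KA u) (subquo_rel_mem uh)).
- exact: mem_full_submod.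
rewrite mem_zero_submod -IB -(subquo_rel_zero uh).
by split=> [->|/eqP].
Qed.

Variables (m : submodClosed R^o) (M : lmodType R) (E : injective_resolution M).
Local Notation obj := (res_obj E).
Local Notation diff := (res_diff E).

(** With [C^j] for [kernel (diff j)], this is [Z^j], and [torsion_bounds j] is [B^j], where
    [B^0 = 0]. *)
Let torsion_cycles j := cap_submod (kernel (diff j)) (torsion m (obj j)).

Let torsion_bounds j : submodClosed (obj j) :=
  if j is k.+1 then map_submod (diff k) (torsion m (obj k)) else zero_submod _.

Lemma klen_local_cohomology j p L :
  klen x (full_submod (local_cohomology m E j)) (zero_submod _) p L ->
  klen x (torsion_cycles j) (torsion_bounds j) p L.
Proof.
have KA k (u : sub_type (torsion m (obj k))) :
    u \in kernel (torsion_map m (diff k)) <-> val u \in torsion_cycles k.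
  split=> [/mk_submodP du0|/mk_submodP[/mk_submodP du0 _]].
    apply/mk_submodP; split; last exact: valP.
    by apply/mk_submodP; have := congr1 val du0; rewrite raddf0.
  by apply/mk_submodP; apply: val_inj; rewrite raddf0.
case: j => [|k]; apply: (klen_subquotient (KA _) _ (@sub_capr _ _ _ _)) => u.
  rewrite mem_zero_submod; split=> [/mk_submodP[v <-]|/eqP u0].
    by rewrite raddf0.
  by apply/mk_submodP; exists 0; apply: val_inj; rewrite u0 !raddf0.
split=> [/mk_submodP[v <-]|/mk_submodP[t Tt tu]].
  by apply/mk_submodP; exists (val v) => //; apply: valP.
apply/mk_submodP; exists (exist (fun v => v \in torsion m (obj k)) t Tt).
exact: val_inj.
Qed.

Hypothesis acyclic_torsion : forall j, koszul_acyclic x (full_submod (obj j)) (torsion m (obj j)).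

Lemma res_exact j : image (diff j) =i kernel (diff j.+1).
Proof. by case: E => obj' diff' aug' injE' inj_aug' im_aug' exact'; apply: exact'. Qed.

Lemma torsion_bounds_cycles j : sub_le (torsion_bounds j) (torsion_cycles j).
Proof.
case: j => [|j]; first exact: zero_submod_le.
move=> u /mk_submodP[t /torsionP[k kt] <-]; apply/mk_submodP; split.
  by rewrite -res_exact; apply/mk_submodP; exists t.
by apply/torsionP; exists k => a /kt at0; rewrite -linearZ at0 linear0.
Qed.

(** The connecting map goes from [C^(j+1) / B^(j+1)] to [C^j / Z^j] with a drop of one degree; its
    source is then filtered through [Z^(j+1)]. *)
Lemma klen_resolution_step j p a b :
  klen x (torsion_cycles j.+1) (torsion_bounds j.+1) p.+1 a ->
  klen x (kernel (diff j.+1)) (torsion_cycles j.+1) p.+1 b ->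
  klen x (kernel (diff j)) (torsion_cycles j) p (a + b).
Proof.
move=> la lb; apply: (klen_connecting (f := diff j)) => //.
apply: (@klen_ext _ _ _ (kernel (diff j.+1)) (torsion_bounds j.+1)) => //.
- exact: res_exact.
- by move=> u /torsion_bounds_cycles; apply: sub_capl.
apply: klen_add la lb; [exact: torsion_bounds_cycles | exact: sub_capl].
Qed.

(** The index [j] and the degree rise together from [j = 0], which is why bounds are needed only for
    [j <= q]. *)
Lemma klen_resolution (b : nat -> nat) p :
  (forall j q, (j <= q)%N -> klen x (torsion_cycles j) (torsion_bounds j) q (b j)) ->
  klen x (full_submod M) (zero_submod M) p (\sum_(0 <= j < n.+1) b j).
Proof.
move=> lb.
(* After [r] steps the degree index reaches [n], where Koszul homology vanishes. *)
have tail r : forall q j, (j <= q)%N -> (n <= q + r)%N ->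
    klen x (kernel (diff j)) (torsion_cycles j) q (\sum_(j.+1 <= k < j.+1 + r) b k).
  elim: r => [|r IHr] q j jq nq.
    by rewrite addn0 big_geq//; apply: klen_vanish; rewrite addn0 in nq.
  rewrite addnS big_ltn ?ltnS ?leq_addr//; apply: klen_resolution_step; first exact: lb.
  by rewrite -addSn; apply: IHr; rewrite ?ltnS// addSnnS.
have lk : klen x (kernel (diff 0)) (torsion_bounds 0) p (\sum_(0 <= j < n.+1) b j).
  rewrite big_ltn//; apply: klen_add (lb 0%N p (leq0n p)) _.
  - exact: torsion_bounds_cycles.
  - exact: sub_capl.
  by have := tail n p 0%N (leq0n p) (leq_addl p n); rewrite add1n.
have [inj_aug im_aug] : injective (res_aug E) /\ image (res_aug E) =i kernel (diff 0).
  by case: E.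
apply: (klen_rel (linear_rel_sym (linear_rel_map (res_aug E)))) lk => [|u _|v|u v _ ->|u v _ ->].
- exact: zero_submod_le.
- by exists (res_aug E u).
- by rewrite -im_aug => /mk_submodP[u <-]; exists u => //; apply: mem_full_submod.
- by rewrite -im_aug; apply/mk_submodP; exists u.
by rewrite !mem_zero_submod (raddf_eq0 _ inj_aug).
Qed.

End LocalCohomologyBound.

(** * From the length bounds to the asymptotic statement *)

Lemma module_neq0 (R : comNzRingType) (M : lmodType R) d :
  has_krull_dim M d -> exists x : M, x <> 0.
Proof.
move=> [[P [pP annP _]] _]; apply: contrapT => nex; have [/negP nP1 _] := pP 0%N (leq0n _).
apply: nP1; apply: (annP 0%N (leq0n _)) => u; rewrite scale1r.
by apply: contrapT => nu; apply: nex; exists u.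
Qed.

Lemma eventually_all (d : nat) (P : nat -> nat -> Prop) :
  (forall j, (j < d)%N -> exists N, forall n, (N <= n)%N -> P j n) ->
  exists N, forall n, (N <= n)%N -> forall j, (j < d)%N -> P j n.
Proof.
elim: d => [|d IHd] evP; first by exists 0%N.
have [|N NP] := IHd; first by move=> j jd; apply/evP/ltnW.
have [N' NP'] := evP d (ltnSn d); exists (maxn N N') => n.
rewrite geq_max => /andP[/NP Pn /NP' Pd] j; rewrite ltnS leq_eqVlt.
by move=> /predU1P[->//|]; apply: Pn.
Qed.

Theorem corollary10p10 (R : comNzRingType) (m : submodClosed R^o) (d : nat)
    (M : nat -> lmodType R) :
  noetherian R -> local_ring m -> has_krull_dim R^o d ->
  strongly_lim_cohen_macaulay m d M -> lim_cohen_macaulay m d M.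
Proof.
move=> noethR loc_m dimR [fgM dimM [E [a [V [artV oV]]]]].
have [x sop_x] := exists_system_of_parameters noethR loc_m dimR.
have [_ x_m rad_x] := sop_x.
split=> // [n|]; first exact: module_neq0 (dimM n).
exists x => // -[//|p] _ e e0.
have /choice[L LP] : forall v, exists L,
    forall q, klen x (full_submod (V v)) (zero_submod (V v)) q L.
  move=> v.
  have /choice[L LP] : forall q, exists L, klen x (full_submod (V v)) (zero_submod (V v)) q L.
    by move=> q; apply: (klen_artinian noethR loc_m.1 rad_x).
  (* For [q >= d] the homology vanishes, so finitely many bounds are summed. *)
  exists (\sum_(q < d) L q)%N => q; case: (ltnP q d) => qd.
    by apply: len_le_leq (LP q); rewrite (bigD1 (Ordinal qd))//= leq_addr.
  by apply: len_le_leq (leq0n _) _; apply: klen_vanish.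
pose c := (\sum_v L v)%N.
have klenV v q : klen x (full_submod (V v)) (zero_submod (V v)) q c.
  by apply: len_le_leq (LP v q); rewrite /c (bigD1 v)//= leq_addr.
(* There are [d] contributions, each at most [c] times a family length; the successor keeps the
   denominator nonzero when [d * c = 0]. *)
pose e' : rat := e / (d * c).+1%:R.
have e'0 : 0 < e' by rewrite divr_gt0 ?ltr0n.
have [N NP] := eventually_all (fun j jd => oV j jd e' e'0).
exists N => n /NP{}NP.
have /choice[l lP] : forall j, exists l, (j < d)%N ->
    family_length V (local_cohomology m (E n) j) = Some l /\ l%:R <= e' * (nu m (M n))%:R.
  move=> j; case: (ltnP j d) => [/NP[l lE le]|_]; last by exists 0%N.
  by exists l.
pose b j := if (j < d)%N then (l j * c)%N else 0%N.
have injE j : injective_module (res_obj (E n) j) by case: (E n).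
have acT j := koszul_acyclic_torsion noethR x_m rad_x (injE j).
have lH : klen x (full_submod (M n)) (zero_submod (M n)) p (\sum_(0 <= j < d.+1) b j).
  apply: (klen_resolution acT) => j q jq.
  (* For [j >= d], the degree [q.+1] exceeds [d] because [j <= q], so the bound [0] holds. *)
  rewrite /b; case: (ltnP j d) => jd; last by apply/klen_vanish/(leq_trans jd).
  apply: klen_local_cohomology; apply: klen_filtration (klenV ^~ q) _.
  by have [/the_natP[]] := lP j jd.
have [k lenE kb] := koszul_homology_length_le lH.
exists k => //.
have bE : ((\sum_(0 <= j < d.+1) b j)%N%:R : rat) <= (d * c)%:R * (e' * (nu m (M n))%:R).
  rewrite big_nat_recr//= {2}/b ltnn addn0 big_mkord natr_sum.
  have -> : (d * c)%:R * (e' * (nu m (M n))%:R) =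
      \sum_(j < d) (c%:R * (e' * (nu m (M n))%:R)) :> rat.
    by rewrite sumr_const card_ord -[RHS]mulr_natl natrM -mulrA.
  apply: ler_sum => j _; rewrite /b ltn_ord natrM mulrC ler_wpM2l//.
  by have [] := lP j (ltn_ord j).
apply: le_trans (le_trans bE _); first by rewrite ler_nat.
rewrite mulrA ler_wpM2r// /e' mulrCA ler_piMr ?(ltW e0)//.
by rewrite ler_pdivrMr ?ltr0n// mul1r ler_nat.
Qed.
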